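(* Let $0<\alpha<2$ and $D\ge 1$. Let $u=(u_1,\dots,u_D)$ and $v=(v_1,\dots,v_D)$ be nonnegative vectors ($u_i\ge 0$, $v_i\ge 0$), each having at least one strictly positive entry. Let $r_1,\dots,r_D$ be i.i.d. symmetric $\alpha$-stable random variables with characteristic function $E\,e^{\sqrt{-1}\,t r_i}=e^{-|t|^\alpha}$, and set $x=\sum_{i=1}^D u_i r_i$, $y=\sum_{i=1}^D v_i r_i$. Let $T_1,\dots,T_D$ be i.i.d. positive random variables with Laplace transform $E\,e^{-sT_i}=e^{-s^{\alpha/2}}$ for $s\ge 0$ (i.e. maximally skewed $\alpha/2$-stable, $T_i\sim S(\alpha/2,1,\cos(\pi\alpha/4))$). Then $$\Pr\big(\mathrm{sign}(x)\neq \mathrm{sign}(y)\big)=E\left(\frac{1}{\pi}\cos^{-1}\left(\frac{\sum_{i=1}^D u_iv_iT_i}{\sqrt{\sum_{i=1}^D u_i^2T_i\sum_{i=1}^D v_i^2T_i}}\right)\right)\le \frac{1}{\pi}\cos^{-1}\rho_\alpha,$$ where $$\rho_\alpha=\left(\frac{\sum_{i=1}^D u_i^{\alpha/2}v_i^{\alpha/2}}{\sqrt{\sum_{i=1}^D u_i^{\alpha}\sum_{i=1}^D v_i^{\alpha}}}\right)^{2/\alpha}.$$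
   Context: $\cos^{-1}$ denotes the principal arccosine with values in $[0,\pi]$. $\mathrm{sign}(\cdot)$ is the sign function; since $x,y$ have continuous distributions, $x=0$ or $y=0$ occurs with probability zero. *)

(* Defs.v *)
From HB Require Import structures.
From mathcomp Require Import all_boot all_order all_algebra.
From mathcomp Require Import all_classical all_reals all_analysis.
Set Implicit Arguments. Unset Strict Implicit. Unset Printing Implicit Defensive.
Import Order.TTheory GRing.Theory Num.Theory.
Local Open Scope classical_set_scope.
Local Open Scope ring_scope.

(* Mutual independence of a finite family of real random variables
   (product rule for all families of Borel sets; taking B i = setT
   recovers every subfamily). *)
Definition mutually_independent {d} {Omega : measurableType d} {R : realType}
  (P : probability Omega R) (D : nat) (X : 'I_D -> {RV P >-> R}) : Prop :=
  forall B : 'I_D -> set R, (forall i, measurable (B i)) ->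
    P (\bigcap_(i in [set: 'I_D]) (X i @^-1` B i)) =
    (\prod_(i < D) P (X i @^-1` B i))%E.

(* Main.v *)
Require Import Defs.
From HB Require Import structures.
From mathcomp Require Import all_boot all_order all_algebra.
From mathcomp Require Import all_classical all_reals all_analysis.
From mathcomp Require Import measurable_realfun ring lra.
Import Order.TTheory GRing.Theory Num.Theory.
Import numFieldNormedType.Exports.
Local Open Scope classical_set_scope.
Local Open Scope ring_scope.
Set Implicit Arguments.
Unset Strict Implicit.
Unset Printing Implicit Defensive.

(* A bounded functional of a pair of random variables obtained as an iterated
   bounded limit of trigonometric polynomials depends only on the joint
   characteristic function; [sg x * sg y] is one, since iterating the cubic
   [z |-> (3 z - z ^ 3) / 2] from [sin (x / m)] converges to the sign of
   [sin (x / m)], hence to that of [x] for large [m]. As [exp (- |t| ^ alpha)]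
   is the Laplace transform of [T] at [t ^ 2], the pair [(x, y)] has the
   characteristic function of a mixture over [T] of centred Gaussian pairs whose
   correlation [c] is the argument of the arccosine. For planar Gaussians the
   probability of a sign change along an angle is rotation invariant and
   additive in the angle, hence is [acos c / pi].

   For the bound, [ln c = ln C - ln A / 2 - ln B / 2], where [A], [B], [C] are
   linear combinations of the [T i], each distributed as an explicit multiple of
   [T], so that [E (ln c) = ln rho] (when some [u i * v i > 0]); since
   [w |-> acos (expR w)] is concave on [w <= 0], Jensen's inequality
   concludes. *)

(** * Expectations of bounded random variables *)

(** For general [alpha] a stable law has no elementary density, so laws are compared only through
    transforms: cosines and sines for [r], exponentials for [T]. The Gaussian side follows suit:
    rotation invariance is itself read off the characteristic function.

    The sign correlation equals 1 - 2 P(sign change) only when [x] and [y] are almost surely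
    nonzero; this is obtained from the same correlation formula for the pair (x, x), whose cosine is
    1.

    For the bound, the obstacle is that [T] may have infinite mean and that E (ln T) is not known
    explicitly. Its finiteness and its dependence on the Laplace transform alone suffice: the
    unknown value cancels because the coefficients 1, -1/2, -1/2 sum to 0. In Jensen's inequality
    the tangent has infinite slope at angle 0, so the point of tangency is taken strictly between
    the two angles being compared. If every [u i * v i] vanishes, no logarithm is available, but
    then [rho] is 0 and pi / 2 bounds the arccosine. *)

Section bounded_measurable.
Context {d} {T : measurableType d} {R : realType}.
Implicit Types f g : T -> R.

(** The bound holds everywhere rather than almost surely, so that closure under sums, products and
    composition is immediate. *)
Definition bmeas f := measurable_fun setT f /\ exists M : R, forall x, `|f x| <= M.

Lemma bmeas_cst (c : R) : bmeas (fun=> c).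
Proof. by split; [exact: measurable_cst|exists `|c|]. Qed.

Lemma bmeasD f g : bmeas f -> bmeas g -> bmeas (fun x => f x + g x).
Proof.
move=> [mf [M fM]] [mg [N gN]]; split; first exact: measurable_funD.
by exists (M + N) => x; rewrite (le_trans (ler_normD _ _))// lerD.
Qed.

Lemma bmeasM f g : bmeas f -> bmeas g -> bmeas (fun x => f x * g x).
Proof.
move=> [mf [M fM]] [mg [N gN]]; split; first exact: measurable_funM.
by exists (M * N) => x; rewrite normrM ler_pM.
Qed.

Lemma bmeasZ (c : R) f : bmeas f -> bmeas (fun x => c * f x).
Proof. by move=> bf; apply: bmeasM => //; exact: bmeas_cst. Qed.

Lemma bmeasN f : bmeas f -> bmeas (fun x => - f x).
Proof.
move=> bf; rewrite (_ : (fun x => _) = fun x => -1 * f x); first exact: bmeasZ.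
by apply/funext => x; rewrite mulN1r.
Qed.

Lemma bmeasB f g : bmeas f -> bmeas g -> bmeas (fun x => f x - g x).
Proof. by move=> bf bg; apply: bmeasD => //; exact: bmeasN. Qed.

Lemma bmeas_prod (I : Type) (s : seq I) (p : pred I) (F : I -> T -> R) :
  (forall i, bmeas (F i)) -> bmeas (fun x => \prod_(i <- s | p i) F i x).
Proof.
move=> bF; elim: s => [|i s ih].
  under eq_fun do rewrite big_nil; exact: bmeas_cst.
under eq_fun do rewrite big_cons; case: (p i) => //.
exact: bmeasM.
Qed.

Lemma bmeas_indic (A : set T) : measurable A -> bmeas \1_A.
Proof.
move=> mA; split; first exact: measurable_indic.
by exists 1 => x; rewrite indicE; case: (_ \in _); rewrite ?normr1 ?normr0.
Qed.

End bounded_measurable.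

Lemma bmeas_comp {d d'} {T : measurableType d} {T' : measurableType d'}
    {R : realType} (f : T' -> R) (g : T -> T') :
  bmeas f -> measurable_fun setT g -> bmeas (fun x => f (g x)).
Proof.
move=> [mf [M fM]] mg; split; first exact: measurableT_comp.
by exists M.
Qed.

Lemma bmeas_cos {R : realType} : bmeas (@cos R).
Proof.
split; last by exists 1 => x; exact: cos_max.
by apply: continuous_measurable_fun; exact: continuous_cos.
Qed.

Lemma bmeas_sin {R : realType} : bmeas (@sin R).
Proof.
split; last by exists 1 => x; exact: sin_max.
by apply: continuous_measurable_fun; exact: continuous_sin.
Qed.

Section bounded_integral.
Context {d} {T : measurableType d} {R : realType} (P : probability T R).
Implicit Types f g : T -> R.

Lemma bmeas_integrable f : bmeas f -> P.-integrable setT (EFin \o f).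
Proof.
move=> [mf [M fM]]; apply: measurable_bounded_integrable => //.
  by apply: (le_lt_trans (probability_le1 P measurableT)); exact: ltry.
exists M; split; first exact: num_real.
by move=> y My x _; exact: le_trans (fM x) (ltW My).
Qed.

Lemma EFin_Rintegral f : bmeas f ->
  (\int[P]_x (f x)%:E)%E = (\int[P]_x f x)%:E.
Proof.
move=> bf; rewrite /Rintegral fineK//.
exact: integrable_fin_num (bmeas_integrable bf).
Qed.

Lemma expectD f g : bmeas f -> bmeas g ->
  \int[P]_x (f x + g x) = \int[P]_x f x + \int[P]_x g x.
Proof. by move=> bf bg; apply: RintegralD => //; exact: bmeas_integrable. Qed.

Lemma expectB f g : bmeas f -> bmeas g ->
  \int[P]_x (f x - g x) = \int[P]_x f x - \int[P]_x g x.
Proof. by move=> bf bg; apply: RintegralB => //; exact: bmeas_integrable. Qed.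

Lemma expectZ (c : R) f : bmeas f -> \int[P]_x (c * f x) = c * \int[P]_x f x.
Proof. by move=> bf; apply: RintegralZl => //; exact: bmeas_integrable. Qed.

Lemma expect_cst (c : R) : \int[P]_x c = c.
Proof. by rewrite Rintegral_cst//= probability_setT/= mulr1. Qed.

Lemma le_expect f g : bmeas f -> bmeas g -> (forall x, f x <= g x) ->
  \int[P]_x f x <= \int[P]_x g x.
Proof.
by move=> bf bg fg; apply: le_Rintegral => //; exact: bmeas_integrable.
Qed.

Lemma ae_eq_expect f g : measurable_fun setT f -> measurable_fun setT g ->
  {ae P, forall x, f x = g x} -> \int[P]_x f x = \int[P]_x g x.
Proof.
move=> mf mg fg; congr fine; apply: ae_eq_integral => //.
- exact/measurable_EFinP.
- exact/measurable_EFinP.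
- by apply: filterS fg => x /= -> _.
Qed.

Lemma dominated_cvg_expect (f_ : nat -> T -> R) (f g : T -> R) :
  (forall n, measurable_fun setT (f_ n)) -> P.-integrable setT (EFin \o g) ->
  (forall n x, `|f_ n x| <= g x) -> (forall x, f_ ^~ x @ \oo --> f x) ->
  (fun n => \int[P]_x f_ n x) @ \oo --> \int[P]_x f x.
Proof.
move=> mf ig fg cf.
have mlim : measurable_fun setT f.
  by apply: measurable_fun_cvg mf _ => x _; exact: cf.
have [] := @dominated_convergence _ _ _ P setT measurableT
  (fun n => EFin \o f_ n) (EFin \o f) (EFin \o g).
- by move=> n; exact/measurable_EFinP.
- exact/measurable_EFinP.
- by apply: aeW => x _; apply: cvg_EFin; [exact: nearW|exact: cf].
- exact: ig.
- by apply: aeW => x n _; rewrite /= lee_fin.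
move=> intf _ cvgf; apply: fine_cvg.
by rewrite fineK//; exact: integrable_fin_num.
Qed.

Lemma bounded_cvg_expect (f_ : nat -> T -> R) f (M : R) :
  (forall n, measurable_fun setT (f_ n)) -> (forall n x, `|f_ n x| <= M) ->
  (forall x, f_ ^~ x @ \oo --> f x) ->
  (fun n => \int[P]_x f_ n x) @ \oo --> \int[P]_x f x.
Proof.
move=> mf; apply: dominated_cvg_expect => //.
exact: bmeas_integrable (bmeas_cst M).
Qed.

Lemma ae_forall_ord n (Q : 'I_n -> T -> Prop) :
  (forall i, {ae P, forall x, Q i x}) -> {ae P, forall x i, Q i x}.
Proof.
move=> aeQ.
have : {ae P, forall x, forall k (i : 'I_n), i = k :> nat -> Q i x}.
  apply: ae_foralln => k; have [kn|nk] := ltnP k n.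
    apply: filterS (aeQ (Ordinal kn)) => x Qx i ik.
    by rewrite (_ : i = Ordinal kn)//; exact: val_inj.
  by apply: aeW => x i ik; move: (ltn_ord i); rewrite ik ltnNge nk.
by apply: filterS => x Qx i; exact: Qx.
Qed.

End bounded_integral.

(** * Iterated expectations on a product space *)

Section bounded_Fubini.
Context {d1} {T1 : measurableType d1} {d2} {T2 : measurableType d2}
  {R : realType} (P1 : probability T1 R) (P2 : probability T2 R).
Implicit Types f : T1 * T2 -> R.

Lemma bmeas_pair1 f (x : T1) : bmeas f -> bmeas (fun y => f (x, y)).
Proof. by move=> bf; apply: bmeas_comp bf _; exact: measurable_pair1. Qed.

Lemma bmeas_expect f : bmeas f -> bmeas (fun x => \int[P2]_y f (x, y)).
Proof.
move=> bf; split.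
  apply/measurable_EFinP.
  have := measurable_fubini_F (bmeas_integrable (P1 \x P2)%E bf).
  apply: eq_measurable_fun => x _; rewrite /fubini_F /= EFin_Rintegral//.
  exact: bmeas_pair1.
have [mf [M fM]] := bf; exists M => x.
apply: le_trans (le_normr_Rintegral measurableT _) _.
  exact/bmeas_integrable/bmeas_pair1.
rewrite -[leRHS](expect_cst P2); apply: le_expect.
- split; first by apply: measurableT_comp => //; case: (bmeas_pair1 x bf).
  by exists M => y; rewrite normr_id.
- exact: bmeas_cst.
- by move=> y; exact: fM.
Qed.

Lemma expect_prod f : bmeas f ->
  \int[(P1 \x P2)%E]_z f z = \int[P1]_x \int[P2]_y f (x, y).
Proof.
move=> bf; apply: EFin_inj; rewrite -!EFin_Rintegral//; last exact: bmeas_expect.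
rewrite -(integral12_prod_meas1 (bmeas_integrable (P1 \x P2)%E bf)).
by apply: eq_integral => x _; rewrite /fubini_F /= EFin_Rintegral//;
  exact: bmeas_pair1.
Qed.

End bounded_Fubini.

(** * Independence *)

Section independence.
Context {d} {Omega : measurableType d} {R : realType} (P : probability Omega R).
Import HBNNSimple.

Lemma expect_indic (A : set Omega) : measurable A ->
  \int[P]_w \1_A w = fine (P A).
Proof. by move=> mA; rewrite /Rintegral integral_indic// setIT. Qed.

(** Usual passage from indicators to simple functions, then by increasing approximation to bounded
    nonnegative functions, then to bounded ones. [W] will be the product of the other factors, so
    that independence is upgraded one variable at a time. *)
Lemma expect_factor (X : {RV P >-> R}) (W : Omega -> R) (c : R) : bmeas W ->
  (forall B, measurable B ->
    \int[P]_w (W w * \1_B (X w)) = c * \int[P]_w \1_B (X w)) ->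
  forall f, bmeas f -> \int[P]_w (W w * f (X w)) = c * \int[P]_w f (X w).
Proof.
move=> bW indicH.
have mX : measurable_fun setT X by [].
pose H f := \int[P]_w (W w * f (X w)) = c * \int[P]_w f (X w).
have HD f g : bmeas f -> bmeas g -> H f -> H g -> H (fun x => f x + g x).
  move=> bf bg Hf Hg; rewrite /H.
  have bfX := bmeas_comp bf mX; have bgX := bmeas_comp bg mX.
  under eq_Rintegral do rewrite mulrDr.
  by rewrite !expectD ?Hf ?Hg ?mulrDr//; exact: bmeasM.
have HZ k f : bmeas f -> H f -> H (fun x => k * f x).
  move=> bf Hf; rewrite /H.
  have bfX := bmeas_comp bf mX.
  under eq_Rintegral do rewrite mulrCA.
  by rewrite !expectZ ?Hf 1?mulrCA//; exact: bmeasM.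
have Hsfun (g : {nnsfun R >-> R}) : H g.
  have -> : (g : R -> R) = fun x =>
      \sum_(y <- (finmap.enum_fset (fset_set (range g)))) y * \1_(g @^-1` [set y]) x.
    apply/funext => x; rewrite fimfunE fsbig_finite//=; exact: eq_bigr.
  elim: (finmap.enum_fset (fset_set (range g))) => [|y s ih].
    rewrite /H; under eq_Rintegral do rewrite big_nil mulr0.
    by under [in RHS]eq_Rintegral do rewrite big_nil; rewrite expect_cst mulr0.
  under eq_fun do rewrite big_cons.
  apply: HD => //.
  - apply: bmeasZ; apply: bmeas_indic; rewrite -[_ @^-1` _]setTI.
    exact: measurable_funP.
  - elim: s {ih} => [|z s ih].
      by under eq_fun do rewrite big_nil; exact: bmeas_cst.
    under eq_fun do rewrite big_cons; apply: bmeasD => //.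
    apply: bmeasZ; apply: bmeas_indic; rewrite -[_ @^-1` _]setTI.
    exact: measurable_funP.
  - apply: HZ.
      apply: bmeas_indic; rewrite -[_ @^-1` _]setTI; exact: measurable_funP.
    by apply: indicH; rewrite -[_ @^-1` _]setTI; exact: measurable_funP.
have Hge0 f : bmeas f -> (forall x, 0 <= f x) -> H f.
  move=> bf f0.
  have mf : measurable_fun setT (EFin \o f) by apply/measurable_EFinP; case: bf.
  have [_ [M fM]] := bf.
  pose g n := nnsfun_approx measurableT mf n.
  have gf n x : 0 <= g n x <= f x.
    rewrite fun_ge0/= -lee_fin /g nnsfun_approxE.
    by apply: le_approx => // y _; rewrite lee_fin.
  have gM n x : `|g n x| <= M.
    have /andP[g0 gfx] := gf n x.
    by rewrite ger0_norm// (le_trans gfx)// (le_trans _ (fM x))// ler_norm.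
  have cg x : g ^~ x @ \oo --> f x.
    apply: (@fine_cvg _ _ _ _ (EFin \o g ^~ x)).
    exact: (@cvg_nnsfun_approx _ _ _ _ measurableT _ mf (fun x _ => f0 x) x I).
  have [_ [MW WM]] := bW.
  have l1 : (fun n => \int[P]_w (W w * g n (X w))) @ \oo --> \int[P]_w (W w * f (X w)).
    apply: (@bounded_cvg_expect _ _ _ _ _ _ (MW * M)).
    - by move=> n; apply: measurable_funM; [case: bW|exact: measurableT_comp].
    - by move=> n w; rewrite normrM ler_pM.
    - by move=> w; apply: cvgM; [exact: cvg_cst|exact: cg].
  have l2 : (fun n => \int[P]_w (W w * g n (X w))) @ \oo --> c * \int[P]_w f (X w).
    under eq_fun do rewrite Hsfun.
    apply: cvgM; first exact: cvg_cst.
    apply: (@bounded_cvg_expect _ _ _ _ _ _ M) => //.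
    by move=> n; exact: measurableT_comp.
  by rewrite /H; exact: (cvg_unique _ l1 l2).
move=> f bf; have [mf [M fM]] := bf.
(* Adding the bound [M] reduces to nonnegative functions, of which the constant [M] is one. *)
have -> : f = fun x => (f x + M) + (-1) * M by apply/funext => x; ring.
have bM : bmeas ((fun=> M) : R -> R) by exact: bmeas_cst.
apply: (HD (fun x => f x + M) (fun=> -1 * M)).
- exact: bmeasD.
- exact: bmeas_cst.
- apply: Hge0; first exact: bmeasD.
  by move=> x; rewrite -lerBlDr sub0r lerNl (le_trans _ (fM x))// -normrN ler_norm.
- apply: (HZ _ (fun=> M)) => //; apply: Hge0 => // _.
  exact: le_trans (fM 0).
Qed.

Variables (D : nat) (X : 'I_D -> {RV P >-> R}).
Hypothesis indep : mutually_independent X.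

Let prod_indic (B : 'I_D -> set R) : (forall i, measurable (B i)) ->
  \int[P]_w \prod_i \1_(B i) (X i w) = \prod_i \int[P]_w \1_(B i) (X i w).
Proof.
move=> mB.
have mXB i : measurable (X i @^-1` B i) by rewrite -[_ @^-1` _]setTI; exact: measurable_funP.
transitivity (\int[P]_w \1_(\bigcap_(i in [set: 'I_D]) (X i @^-1` B i)) w).
  apply: eq_Rintegral => w _; rewrite indicE.
  have [|] := boolP (w \in _).
    rewrite inE => wB; rewrite big1// => i _.
    by rewrite indicE mem_set//; exact: wB.
  rewrite notin_setE => /existsNP[i /not_implyP[_ nB]].
  by rewrite (bigD1 i)//= indicE memNset// mul0r.
rewrite expect_indic; last by apply: fin_bigcap_measurable => //; exact: finite_finset.
rewrite indep//.
transitivity (\prod_i fine (P (X i @^-1` B i))).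
  apply: EFin_inj; rewrite -prodEFin fineK.
    by apply: eq_bigr => i _; rewrite fineK// fin_num_measure.
  by rewrite -indep// fin_num_measure//; apply: fin_bigcap_measurable => //; exact: finite_finset.
by apply: eq_bigr => i _; rewrite -expect_indic.
Qed.

Lemma expect_prod_indep (f : 'I_D -> R -> R) : (forall i, bmeas (f i)) ->
  \int[P]_w \prod_i f i (X i w) = \prod_i \int[P]_w f i (X i w).
Proof.
(* Indices below [k] carry arbitrary bounded functions, the others still carry indicators. For [k] =
   0 this is the definition of independence, and each step frees one index. *)
suff: forall k (g : 'I_D -> R -> R), (forall i, bmeas (g i)) ->
    (forall i : 'I_D, (k <= i)%N -> exists2 B, measurable B & g i = \1_B) ->
    \int[P]_w \prod_i g i (X i w) = \prod_i \int[P]_w g i (X i w).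
  by move=> /(_ D) h bf; apply: h => // i; rewrite leqNgt ltn_ord.
have mX i : measurable_fun setT (X i) by [].
elim=> [|k ih] g bg gind.
  have /choice[B /all_and2[mB gB]] : forall i, exists B, measurable B /\ g i = \1_B.
    by move=> i; have [//|B mB gB] := gind i; exists B.
  transitivity (\int[P]_w \prod_i \1_(B i) (X i w)).
    by apply: eq_Rintegral => w _; apply: eq_bigr => i _; rewrite gB.
  by rewrite prod_indic//; apply: eq_bigr => i _; rewrite gB.
have [kD|Dk] := ltnP k D; last first.
  by apply: ih => // i ki; have := leq_ltn_trans ki (ltn_ord i); rewrite ltnNge Dk.
pose i0 := Ordinal kD.
rewrite (bigD1 i0)//=.
under eq_Rintegral do rewrite (bigD1 i0)//= mulrC.
rewrite [RHS]mulrC.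
have bW : bmeas (fun w => \prod_(i | i != i0) g i (X i w)).
  by apply: bmeas_prod => i; exact: bmeas_comp.
apply: (expect_factor bW) => // B mB.
(* Freezing the factor at [i0] to an indicator puts the family back under the induction hypothesis;
   this is the premise of [expect_factor]. *)
pose g' i := if i == i0 then \1_B else g i.
have g'i0 : g' i0 = \1_B by rewrite /g' eqxx.
have g'n i : i != i0 -> g' i = g i by rewrite /g' => /negbTE ->.
have := ih g'; rewrite (bigD1 i0)//= g'i0.
under eq_Rintegral do rewrite (bigD1 i0)//= g'i0 mulrC.
under eq_Rintegral do under eq_bigr do rewrite g'n//.
have -> : \prod_(i | i != i0) \int[P]_w g' i (X i w) =
    \prod_(i | i != i0) \int[P]_w g i (X i w).
  by apply: eq_bigr => i ii0; rewrite g'n.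
rewrite (mulrC (\int[P]_w _)); apply.
- by move=> i; rewrite /g'; case: ifP => // _; exact: bmeas_indic.
- move=> i ki; rewrite /g'; case: ifP => [_|/negbT ii0]; first by exists B.
  by apply: gind; rewrite ltn_neqAle ki andbT eq_sym; apply: contra ii0 => /eqP ik; apply/eqP/val_inj.
Qed.

(** The joint characteristic function is the product of the individual ones; vanishing sine
    expectations make all of them real. *)
Lemma expect_cos_sin_indep (a : 'I_D -> R) :
  (forall i, \int[P]_w sin (a i * X i w) = 0) ->
  \int[P]_w cos (\sum_i a i * X i w) = \prod_i \int[P]_w cos (a i * X i w) /\
  \int[P]_w sin (\sum_i a i * X i w) = 0.
Proof.
move=> sinX0.
have mX i : measurable_fun setT (X i) by [].
have baX (f : R -> R) i : bmeas f -> bmeas (fun x => f (a i * x)).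
  by move=> bf; apply: bmeas_comp => //; exact: measurable_funM.
(* When an index [j] enters the sum, the addition formula leaves a factor cos or sin of [a j * X j].
   The free functions [g] outside [s] are there to store it, so that the hypothesis for the shorter
   list applies. *)
suff: forall s (g : 'I_D -> R -> R), uniq s -> (forall i, bmeas (g i)) ->
    \int[P]_w (cos (\sum_(i <- s) a i * X i w) * \prod_(i | i \notin s) g i (X i w)) =
      (\prod_(i <- s) \int[P]_w cos (a i * X i w)) *
      \prod_(i | i \notin s) \int[P]_w g i (X i w) /\
    \int[P]_w (sin (\sum_(i <- s) a i * X i w) *
      \prod_(i | i \notin s) g i (X i w)) = 0.
  move=> /(_ (index_enum 'I_D) (fun=> cst 1) (index_enum_uniq _)).
  move=> /(_ (fun=> bmeas_cst 1)).
  have prod1 (F : 'I_D -> R) : \prod_(i | i \notin index_enum 'I_D) F i = 1.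
    by rewrite big_pred0// => i; rewrite mem_index_enum.
  rewrite prod1 mulr1; under eq_Rintegral do rewrite prod1 mulr1.
  move=> [-> sinS]; split => //; rewrite -[RHS]sinS.
  by apply: eq_Rintegral => w _; rewrite prod1 mulr1.
elim=> [|j s ih] g us bg.
  split.
    under eq_Rintegral do rewrite big_nil cos0 mul1r.
    by rewrite big_nil mul1r expect_prod_indep.
  by under eq_Rintegral do rewrite big_nil sin0 mul0r; rewrite expect_cst.
move: us => /= /andP[js us].
pose upd f i := if i == j then f else g i.
have updj f : upd f j = f by rewrite /upd eqxx.
have updn f i : i != j -> upd f i = g i by rewrite /upd => /negbTE ->.
have bupd f i : bmeas f -> bmeas (upd f i) by rewrite /upd; case: ifP.
have notins i : (i \notin s) && (i != j) = (i \notin j :: s).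
  by rewrite inE negb_or andbC.
have prod_upd f w : \prod_(i | i \notin s) upd f i (X i w) =
    f (X j w) * \prod_(i | i \notin j :: s) g i (X i w).
  rewrite (bigD1 j)//= updj; congr (_ * _); apply: eq_big => // i.
  by move=> /andP[_ ij]; rewrite updn.
have prod_Eupd f : \prod_(i | i \notin s) \int[P]_w upd f i (X i w) =
    \int[P]_w f (X j w) * \prod_(i | i \notin j :: s) \int[P]_w g i (X i w).
  rewrite (bigD1 j)//= updj; congr (_ * _); apply: eq_big => // i.
  by move=> /andP[_ ij]; rewrite updn.
pose S w := \sum_(i <- s) a i * X i w.
pose G w := \prod_(i | i \notin j :: s) g i (X i w).
have mS : measurable_fun setT S by apply: measurable_sum => i; exact: measurable_funM.
have bG : bmeas G by apply: bmeas_prod => i; exact: bmeas_comp.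
have bcosS : bmeas (cos \o S) by exact: bmeas_comp bmeas_cos mS.
have bsinS : bmeas (sin \o S) by exact: bmeas_comp bmeas_sin mS.
have bcos : bmeas (fun w => cos (a j * X j w)).
  exact: bmeas_comp (baX _ j bmeas_cos) (mX j).
have bsin : bmeas (fun w => sin (a j * X j w)).
  exact: bmeas_comp (baX _ j bmeas_sin) (mX j).
have [cc sc] := ih (upd (fun x => cos (a j * x))) us (fun i => bupd _ i (baX _ j bmeas_cos)).
have [cs ss] := ih (upd (fun x => sin (a j * x))) us (fun i => bupd _ i (baX _ j bmeas_sin)).
rewrite prod_Eupd in cc; rewrite prod_Eupd sinX0 mul0r mulr0 in cs.
have fold_upd h f : \int[P]_w (h (S w) * (f (X j w) * G w)) =
    \int[P]_w (h (\sum_(i <- s) a i * X i w) *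
               \prod_(i | i \notin s) upd f i (X i w)).
  by apply: eq_Rintegral => w _; rewrite prod_upd.
rewrite -(fold_upd cos (fun x => cos (a j * x))) in cc.
rewrite -(fold_upd cos (fun x => sin (a j * x))) in cs.
rewrite -(fold_upd sin (fun x => cos (a j * x))) in sc.
rewrite -(fold_upd sin (fun x => sin (a j * x))) in ss.
split.
  transitivity (\int[P]_w (cos (S w) * (cos (a j * X j w) * G w) -
                           sin (S w) * (sin (a j * X j w) * G w))).
    by apply: eq_Rintegral => w _; rewrite big_cons cosD -/(S w) -/(G w); ring.
  rewrite expectB; [|by do 2 apply: bmeasM => //..].
  by rewrite big_cons cc ss; ring.
transitivity (\int[P]_w (cos (S w) * (sin (a j * X j w) * G w) +
                         sin (S w) * (cos (a j * X j w) * G w))).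
  by apply: eq_Rintegral => w _; rewrite big_cons sinD -/(S w) -/(G w); ring.
rewrite expectD; [|by do 2 apply: bmeasM => //..].
by rewrite cs sc addr0.
Qed.

(** Independence is applied through [Num.max x 0], for which the exponential is bounded by 1 on the
    whole line. Almost surely this, [X i] and the everywhere positive version on the left
    coincide. *)
Lemma expect_expR_indep (s : 'I_D -> R) : (forall i, 0 <= s i) ->
  (forall i, {ae P, forall w, 0 < X i w}) ->
  \int[P]_w expR (- \sum_i s i * (if 0 < X i w then X i w else 1)) =
  \prod_i \int[P]_w expR (- (s i * X i w)).
Proof.
move=> s0 X0.
have mX i : measurable_fun setT (X i) by [].
have mX' i : measurable_fun setT (fun w => if 0 < X i w then X i w else 1).
  apply: measurable_fun_ifT => //; exact: measurable_fun_ltr.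
pose f i (x : R) := expR (- (s i * Num.max x 0)).
have bf i : bmeas (f i).
  split.
    apply: measurableT_comp => //; apply: measurableT_comp => //.
    by apply: measurable_funM => //; exact: measurable_maxr.
  exists 1 => x; rewrite ger0_norm ?expR_ge0// -expR0 ler_expR oppr_le0 mulr_ge0//.
  by rewrite le_max lexx orbT.
transitivity (\int[P]_w \prod_i f i (X i w)).
  apply: ae_eq_expect.
  - apply: measurableT_comp => //; apply: measurableT_comp => //.
    by apply: measurable_sum => i; exact: measurable_funM.
  - by apply: measurable_prod => i _; exact: measurableT_comp (bf i).1 _.
  - apply: filterS (ae_forall_ord X0) => w Xw; rewrite -sumrN expR_sum.
    by apply: eq_bigr => i _; rewrite /f Xw max_l// ltW.
rewrite expect_prod_indep//; apply: eq_bigr => i _.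
apply: ae_eq_expect.
- exact: measurableT_comp (bf i).1 _.
- apply: measurableT_comp => //; apply: measurableT_comp => //.
  exact: measurable_funM.
- by apply: filterS (X0 i) => w Xw; rewrite /f max_l// ltW.
Qed.

End independence.

(** * The characteristic function determines the correlation of the signs *)

Lemma measurable_sgr {R : realType} : measurable_fun setT (@Num.sg R).
Proof.
rewrite (_ : Num.sg = fun x : R => if 0 < x then 1 else if x < 0 then -1 else 0).
  apply: measurable_fun_ifT => //; first exact: measurable_fun_ltr.
  by apply: measurable_fun_ifT => //; exact: measurable_fun_ltr.
by apply/funext => x; case: sgrP => //; rewrite ltxx.
Qed.

Lemma bmeas_sgr {R : realType} : bmeas (@Num.sg R).
Proof.
split; first exact: measurable_sgr.
by exists 1 => x; rewrite normr_sg; case: eqP => _; rewrite ?ler01.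
Qed.

(** * Approximation of the sign by trigonometric polynomials *)

Section sign_approximation.
Context {R : realType}.
Implicit Types x y z : R.

(* The fixed points of [sign_step] on [-1, 1] are -1, 0 and 1, and 0 is repelling:
   the iterates of [q] are polynomials converging to the sign function. *)
Definition sign_step z : R := (3 * z - z ^+ 3) / 2.

Lemma sign_stepN z : sign_step (- z) = - sign_step z.
Proof. by rewrite /sign_step; field. Qed.

Lemma iter_sign_stepN n z : iter n sign_step (- z) = - iter n sign_step z.
Proof. by elim: n => //= n ->; rewrite sign_stepN. Qed.

(** The distance to 1 is multiplied by 1 - (w + w^2) / 2 at each step. Iterates never fall below
    [z], so this factor is at most 1 - z / 2. *)
Lemma iter_sign_step_bound n z : 0 < z <= 1 ->
  [/\ z <= iter n sign_step z, iter n sign_step z <= 1 &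
      1 - iter n sign_step z <= (1 - z / 2) ^+ n].
Proof.
move=> /andP[z0 z1]; elim: n => [|n [ih1 ih2 ih3]].
  by split => //=; rewrite expr0; lra.
rewrite iterS exprS; set w := iter n sign_step z in ih1 ih2 ih3 *.
have w0 : 0 < w by apply: lt_le_trans ih1.
have e : 1 - sign_step w = (1 - (w + w ^+ 2) / 2) * (1 - w).
  by rewrite /sign_step; field.
have wz : (w + w ^+ 2) / 2 >= z / 2 by nra.
split.
- rewrite (le_trans ih1)// -subr_ge0 (_ : _ - _ = w * (1 - w) * (1 + w) / 2); last first.
    by rewrite /sign_step; field.
  by rewrite !mulr_ge0//; lra.
- by rewrite -subr_ge0 e mulr_ge0//; nra.
- by rewrite e ler_pM//; [nra|lra|lra].
Qed.

Lemma iter_sign_step_le1 n z : `|z| <= 1 -> `|iter n sign_step z| <= 1.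
Proof.
move=> z1; have [z0|z0|->] := ltgtP z 0.
- have [|_ + _] := @iter_sign_step_bound n (- z).
    by rewrite oppr_gt0 z0 -(ltr0_norm z0).
  rewrite iter_sign_stepN => h; rewrite ler_norml; apply/andP; split; first lra.
  have [|+ _ _] := @iter_sign_step_bound n (- z).
    by rewrite oppr_gt0 z0 -(ltr0_norm z0).
  by rewrite iter_sign_stepN; lra.
- have [|h1 h2 _] := @iter_sign_step_bound n z; first by rewrite z0 -(gtr0_norm z0).
  by rewrite ler_norml h2 andbT; lra.
- have -> : iter n sign_step (0 : R) = 0.
    by elim: n => //= n ->; rewrite /sign_step; field.
  by rewrite normr0.
Qed.

Lemma cvg_iter_sign_step z : `|z| <= 1 ->
  (fun n => iter n sign_step z) @ \oo --> Num.sg z.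
Proof.
have pos y : 0 < y <= 1 -> (fun n => iter n sign_step y) @ \oo --> (1 : R).
  move=> y01; have /andP[y0 y1] := y01.
  have geo : (fun n => 1 - (1 - y / 2) ^+ n) @ \oo --> (1 : R).
    rewrite -[X in _ --> X]subr0; apply: cvgB; first exact: cvg_cst.
    by apply: cvg_expr; rewrite ger0_norm; lra.
  apply: (squeeze_cvgr (h := cst (1 : R)) _ geo); last exact: cvg_cst.
  apply: nearW => n.
  by have [h1 h2 h3] := iter_sign_step_bound n y01; rewrite /=; apply/andP; split; lra.
move=> z1; have [z0|z0|->] := ltgtP z 0.
- rewrite ltr0_sg//.
  rewrite (_ : (fun n => _) = fun n => - iter n sign_step (- z)); last first.
    by apply/funext => n; rewrite iter_sign_stepN opprK.
  by apply: cvgN; apply: pos; rewrite oppr_gt0 z0 -(ltr0_norm z0).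
- by rewrite gtr0_sg//; apply: pos; rewrite z0 -(gtr0_norm z0).
- rewrite sgr0 (_ : (fun n => _) = fun=> 0); first exact: cvg_cst.
  by apply/funext; elim => //= n ->; rewrite /sign_step; field.
Qed.

(** The sequence is eventually constant: once [m] exceeds |x| the argument lies in (-pi, pi), where
    the sine has the sign of its argument. *)
Lemma cvg_sgr_sin x : (fun m => Num.sg (sin (m.+1%:R^-1 * x))) @ \oo --> Num.sg x.
Proof.
apply: cvg_near_cst; near=> m.
have m0 : 0 < (m.+1%:R^-1 : R) by rewrite invr_gt0.
have xm : `|m.+1%:R^-1 * x| < pi.
  rewrite normrM gtr0_norm// mulrC ltr_pdivrMr//.
  have xm : `|x| <= m%:R by near: m; exact: nbhs_infty_ger.
  have := @pi_ge2 R; have := ler0n R m; rewrite -natr1; nra.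
have e y : 0 < y < pi -> Num.sg (sin y) = 1 by move=> /sin_gt0_pi/gtr0_sg.
have [x0|x0|->] := ltgtP x 0; last by rewrite mulr0 sin0.
- rewrite (ltr0_sg x0) -[_ * x]opprK sinN sgrN e// -mulrN; apply/andP; split.
    by rewrite mulr_gt0// oppr_gt0.
  by rewrite (le_lt_trans (ler_norm _))// mulrN normrN.
- rewrite (gtr0_sg x0) e// pmulr_rgt0// x0/=.
  by rewrite (le_lt_trans (ler_norm _)).
Unshelve. all: end_near. Qed.

End sign_approximation.

Section trigonometric_polynomials.
Context {R : realType}.

(** The free phase [c] covers sines and keeps the product-to-sum formula inside the class; closure
    under products then admits the iterates of a cubic. *)
Inductive trigpoly : (R -> R -> R) -> Prop :=
| trigpoly_cos s t c : trigpoly (fun x y => cos (s * x + t * y + c))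
| trigpolyD f g : trigpoly f -> trigpoly g -> trigpoly (fun x y => f x y + g x y)
| trigpolyZ k f : trigpoly f -> trigpoly (fun x y => k * f x y).

Lemma trigpolyM f g : trigpoly f -> trigpoly g ->
  trigpoly (fun x y => f x y * g x y).
Proof.
elim=> [s t c|f1 f2 _ ih1 _ ih2|k f1 _ ih] tg.
- elim: tg => [s' t' c'|g1 g2 _ ih1 _ ih2|k g1 _ ih].
  + rewrite (_ : (fun x y => _) = fun x y =>
        2^-1 * cos ((s + s') * x + (t + t') * y + (c + c')) +
        2^-1 * cos ((s - s') * x + (t - t') * y + (c - c'))).
      by apply: trigpolyD; apply: trigpolyZ; exact: trigpoly_cos.
    apply/funext => x; apply/funext => y.
    rewrite (_ : _ + (c + c') = (s * x + t * y + c) + (s' * x + t' * y + c')); last ring.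
    rewrite (_ : _ + (c - c') = (s * x + t * y + c) - (s' * x + t' * y + c')); last ring.
    move: (_ + _ + c) (_ + _ + c') => a b; by rewrite cosD cosB; field.
  + rewrite (_ : (fun x y => _) = fun x y =>
        cos (s * x + t * y + c) * g1 x y + cos (s * x + t * y + c) * g2 x y).
      exact: trigpolyD.
    by apply/funext => x; apply/funext => y; rewrite mulrDr.
  + rewrite (_ : (fun x y => _) = fun x y => k * (cos (s * x + t * y + c) * g1 x y)).
      exact: trigpolyZ.
    by apply/funext => x; apply/funext => y; rewrite mulrCA.
- rewrite (_ : (fun x y => _) = fun x y => f1 x y * g x y + f2 x y * g x y).
    by apply: trigpolyD; [exact: ih1|exact: ih2].
  by apply/funext => x; apply/funext => y; rewrite mulrDl.
- rewrite (_ : (fun x y => _) = fun x y => k * (f1 x y * g x y)).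
    by apply: trigpolyZ; exact: ih.
  by apply/funext => x; apply/funext => y; rewrite mulrA.
Qed.

Lemma trigpoly_iter_sign_step n f : trigpoly f ->
  trigpoly (fun x y => iter n sign_step (f x y)).
Proof.
move=> tf; elim: n => [//|n ih] /=; set g := fun x y => iter n sign_step (f x y).
rewrite (_ : (fun x y => _) = fun x y =>
    3 / 2 * g x y + - 2^-1 * (g x y * (g x y * g x y))).
  by apply: trigpolyD; apply: trigpolyZ => //; do 2 apply: trigpolyM => //.
by apply/funext => x; apply/funext => y; rewrite /sign_step -/(g x y); field.
Qed.

Lemma trigpoly_sin s t : trigpoly (fun x y => sin (s * x + t * y)).
Proof.
rewrite (_ : (fun x y => _) = fun x y => cos (s * x + t * y + - (pi / 2))).
  exact: trigpoly_cos.
by apply/funext => x; apply/funext => y; rewrite cosBpihalf.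
Qed.

End trigonometric_polynomials.

Section characteristic_function.
Context {R : realType} {d} {T : measurableType d} {d'} {T' : measurableType d'}
  (P : probability T R) (P' : probability T' R).

Lemma expect_sgrM_eq (x y : T -> R) (x' y' : T' -> R) :
  measurable_fun setT x -> measurable_fun setT y ->
  measurable_fun setT x' -> measurable_fun setT y' ->
  (forall s t, \int[P]_w cos (s * x w + t * y w) =
               \int[P']_w cos (s * x' w + t * y' w)) ->
  (forall s t, \int[P]_w sin (s * x w + t * y w) =
               \int[P']_w sin (s * x' w + t * y' w)) ->
  \int[P]_w (Num.sg (x w) * Num.sg (y w)) =
  \int[P']_w (Num.sg (x' w) * Num.sg (y' w)).
Proof.
move=> mx my mx' my' ecos esin.
have mlin d1 (S : measurableType d1) (a b : S -> R) s t : measurable_fun setT a ->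
    measurable_fun setT b -> measurable_fun setT (fun w => s * a w + t * b w).
  by move=> ma mb; apply: measurable_funD; exact: measurable_funM.
(* The hypotheses on the characteristic functions enter here: a cosine with phase [c] splits into
   the cosine and the sine that they control. *)
have tpP f : trigpoly f -> [/\ bmeas (fun w => f (x w) (y w)),
    bmeas (fun w => f (x' w) (y' w)) &
    \int[P]_w f (x w) (y w) = \int[P']_w f (x' w) (y' w)].
  elim=> [s t c|f1 f2 _ [b1 b1' e1] _ [b2 b2' e2]|k f1 _ [b1 b1' e1]].
  - have bc d1 (S : measurableType d1) (a b : S -> R) : measurable_fun setT a ->
        measurable_fun setT b -> bmeas (fun w => cos (s * a w + t * b w)).
      by move=> ma mb; apply: bmeas_comp bmeas_cos _; exact: mlin.
    have bs d1 (S : measurableType d1) (a b : S -> R) : measurable_fun setT a ->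
        measurable_fun setT b -> bmeas (fun w => sin (s * a w + t * b w)).
      by move=> ma mb; apply: bmeas_comp bmeas_sin _; exact: mlin.
    split.
    + apply: bmeas_comp bmeas_cos _; apply: measurable_funD => //; exact: mlin.
    + apply: bmeas_comp bmeas_cos _; apply: measurable_funD => //; exact: mlin.
    + transitivity (\int[P]_w (cos c * cos (s * x w + t * y w) -
                               sin c * sin (s * x w + t * y w))).
        by apply: eq_Rintegral => w _; rewrite cosD; ring.
      transitivity (\int[P']_w (cos c * cos (s * x' w + t * y' w) -
                               sin c * sin (s * x' w + t * y' w))); last first.
        by apply: eq_Rintegral => w _; rewrite [in RHS]cosD; ring.
      rewrite !expectB; try (apply: bmeasZ; by [exact: bc|exact: bs]).
      by rewrite !expectZ ?ecos ?esin//; by [exact: bc|exact: bs].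
  - by split; [exact: bmeasD|exact: bmeasD|rewrite !expectD// e1 e2].
  - by split; [exact: bmeasZ|exact: bmeasZ|rewrite !expectZ// e1].
have sg1 (z : R) : `|Num.sg z| <= 1 by rewrite normr_sg; case: eqP.
have step1 m : \int[P]_w (Num.sg (sin (m.+1%:R^-1 * x w)) *
                             Num.sg (sin (m.+1%:R^-1 * y w))) =
    \int[P']_w (Num.sg (sin (m.+1%:R^-1 * x' w)) *
                Num.sg (sin (m.+1%:R^-1 * y' w))).
  set a : R := m.+1%:R^-1.
  (* The zero coefficients present each one-variable sine as the sine of a linear form in both
     variables, the shape of [trigpoly_sin]. *)
  pose f n (u v : R) := iter n sign_step (sin (a * u + 0 * v)) *
                        iter n sign_step (sin (0 * u + a * v)).
  have tf n : trigpoly (f n).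
    by apply: trigpolyM; apply: trigpoly_iter_sign_step; exact: trigpoly_sin.
  have fle n u v : `|f n u v| <= 1.
    by rewrite normrM mulr_ile1// iter_sign_step_le1// sin_max.
  have cf u v : f ^~ u ^~ v @ \oo --> Num.sg (sin (a * u)) * Num.sg (sin (a * v)).
    rewrite /f; apply: cvgM.
      by rewrite mul0r addr0; apply: cvg_iter_sign_step; exact: sin_max.
    by rewrite mul0r add0r; apply: cvg_iter_sign_step; exact: sin_max.
  have l1 : (fun n => \int[P]_w f n (x w) (y w)) @ \oo -->
      \int[P]_w (Num.sg (sin (a * x w)) * Num.sg (sin (a * y w))).
    apply: (@bounded_cvg_expect _ _ _ _ _ _ 1) => //.
    by move=> n; have [[]] := tpP _ (tf n).
  have l2 : (fun n => \int[P]_w f n (x w) (y w)) @ \oo -->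
      \int[P']_w (Num.sg (sin (a * x' w)) * Num.sg (sin (a * y' w))).
    rewrite (_ : (fun n => _) = fun n => \int[P']_w f n (x' w) (y' w)); last first.
      by apply/funext => n; have [_ _ ->] := tpP _ (tf n).
    apply: (@bounded_cvg_expect _ _ _ _ _ _ 1) => //.
    by move=> n; have [_ []] := tpP _ (tf n).
  exact: (cvg_unique _ l1 l2).
have msin d1 (S : measurableType d1) (a : S -> R) (k : R) : measurable_fun setT a ->
    measurable_fun setT (fun w => Num.sg (sin (k * a w))).
  move=> ma; apply: measurableT_comp; first exact: measurable_sgr.
  apply: measurableT_comp; first exact: bmeas_sin.1.
  exact: measurable_funM.
have l1 : (fun m => \int[P]_w (Num.sg (sin (m.+1%:R^-1 * x w)) *
    Num.sg (sin (m.+1%:R^-1 * y w)))) @ \oo --> \int[P]_w (Num.sg (x w) * Num.sg (y w)).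
  apply: (@bounded_cvg_expect _ _ _ _ _ _ 1).
  - by move=> n; apply: measurable_funM; exact: msin.
  - by move=> n w; rewrite normrM mulr_ile1.
  - by move=> w; apply: cvgM; exact: cvg_sgr_sin.
have l2 : (fun m => \int[P]_w (Num.sg (sin (m.+1%:R^-1 * x w)) *
    Num.sg (sin (m.+1%:R^-1 * y w)))) @ \oo --> \int[P']_w (Num.sg (x' w) * Num.sg (y' w)).
  under eq_fun do rewrite step1.
  apply: (@bounded_cvg_expect _ _ _ _ _ _ 1).
  - by move=> n; apply: measurable_funM; exact: msin.
  - by move=> n w; rewrite normrM mulr_ile1.
  - by move=> w; apply: cvgM; exact: cvg_sgr_sin.
exact: (cvg_unique _ l1 l2).
Qed.

End characteristic_function.

(** * The standard normal distribution *)

Section derivatives.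
Context {R : realType}.
Implicit Types (f g : R -> R) (x a b : R).

Lemma is_derive_mul f g x a b : is_derive x 1 f a -> is_derive x 1 g b ->
  is_derive x 1 (fun y => f y * g y) (a * g x + f x * b).
Proof.
move=> hf hg; have h := is_deriveM hf hg.
by apply: (@is_derive_eq _ _ _ _ _ _ _ _ h); rewrite /GRing.scale/=; ring.
Qed.

Lemma is_derive_comp f g x a b : is_derive (g x) 1 f a -> is_derive x 1 g b ->
  is_derive x 1 (fun y => f (g y)) (a * b).
Proof. exact: is_derive1_comp. Qed.

Lemma is_derive_affine k c x : is_derive x 1 (fun y => k * y + c) k.
Proof.
have h := is_deriveD (is_deriveZ k (is_derive_id x 1)) (is_derive_cst c x 1).
by apply: (@is_derive_eq _ _ _ _ _ _ _ _ h); rewrite /GRing.scale/=; ring.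
Qed.

Lemma is_derive_halfsqr k x : is_derive x 1 (fun y => k * (y ^+ 2 / 2)) (k * x).
Proof.
have h1 := is_derive_affine 1 0 x; have h2 := is_derive_affine (k / 2) 0 x.
have := is_derive_mul h1 h2.
rewrite (_ : (fun y => _) = fun y => k * (y ^+ 2 / 2)).
  by move=> h; apply: (@is_derive_eq _ _ _ _ _ _ _ _ h); field.
by apply/funext => y; field.
Qed.

End derivatives.

Section standard_normal.
Context {R : realType}.
Notation mu := (@lebesgue_measure R).

Definition std_normal : probability (measurableTypeR R) R := normal_prob 0 1.

Let p (x : R) := normal_pdf 0 1 x.

Let pE x : p x = normal_peak 1 * expR (- (x ^+ 2 / 2)).
Proof.
by rewrite /p normal_pdfE ?oner_eq0// /normal_fun subr0 expr1n mulNr.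
Qed.

Let mp : measurable_fun setT p.
Proof. exact: measurable_normal_pdf. Qed.

Let p0 x : 0 <= p x.
Proof. exact: normal_pdf_ge0. Qed.

Let is_derive_p (x : R) : is_derive x 1 p (- x * p x).
Proof.
rewrite (_ : p = fun x => normal_peak 1 * expR (- (x ^+ 2 / 2))); last exact/funext.
have h : is_derive x 1 (fun x => normal_peak 1 * expR (-1 * (x ^+ 2 / 2)))
    (0 * expR (-1 * (x ^+ 2 / 2)) +
     normal_peak 1 * (expR (-1 * (x ^+ 2 / 2)) * (-1 * x))).
  apply: is_derive_mul; apply: is_derive_comp; exact: is_derive_halfsqr.
rewrite (_ : (fun y : R => _) = fun x => normal_peak 1 * expR (-1 * (x ^+ 2 / 2))).
  by apply: (@is_derive_eq _ _ _ _ _ _ _ _ h); rewrite mulN1r; ring.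
by apply/funext => y; rewrite mulN1r.
Qed.

(** The Radon-Nikodym derivative of the normal law agrees almost everywhere with its density, both
    having the same integral over every measurable set. *)
Lemma expect_std_normal f : bmeas f ->
  \int[std_normal]_x f x = \int[mu]_x (f x * p x).
Proof.
move=> bf; congr fine.
have dom : normal_prob 0 1 `<< mu by exact: normal_prob_dominates.
rewrite -(Radon_Nikodym_change_of_variables dom)//=; last exact: bmeas_integrable.
have mf := bf.1.
apply: ae_eq_integral => //.
- by apply: emeasurable_funM => //; exact/measurable_EFinP.
- by apply/measurable_EFinP; exact: measurable_funM.
- under [X in ae_eq _ _ _ X]eq_fun do rewrite EFinM.
  apply: ae_eqe_mul2l => /=.
  rewrite Radon_NikodymE//=.
  case: cid => /= h [h1 h2 h3].
  apply: integral_ae_eq => //=.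
  + by apply/measurable_EFinP.
  + by move=> E E01 mE; rewrite -h3//=.
Qed.

Let integrable_p : mu.-integrable setT (EFin \o p).
Proof. exact: integrable_normal_pdf. Qed.

(** Dominating function for integration by parts and for differentiation under the integral. Since
    |x| exp(- x^2 / 4) <= 2, it lies below [c] times the density of variance 2. *)
Let integrable_xp : mu.-integrable setT (EFin \o (fun x => `|x| * p x)).
Proof.
have s2 : Num.sqrt 2 != 0 :> R by rewrite gt_eqF// sqrtr_gt0.
have np2 : normal_peak (Num.sqrt 2) != 0 :> R by rewrite gt_eqF// normal_peak_gt0.
pose c : R := 2 * (normal_peak 1 / normal_peak (Num.sqrt 2)).
apply: (@le_integrable _ _ _ mu setT measurableT _
    (fun x => c%:E * (normal_pdf 0 (Num.sqrt 2) x)%:E)%E).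
- by apply/measurable_EFinP; apply: measurable_funM => //; exact: measurableT_comp.
- move=> x _; rewrite -EFinM /= lee_fin ger0_norm ?mulr_ge0// (le_trans _ (ler_norm _))//.
  rewrite normal_pdfE// pE /normal_fun subr0 sqr_sqrtr//.
  rewrite [leRHS](_ : _ = normal_peak 1 * (2 * expR (- (x ^+ 2 / 4)))); last first.
    rewrite /c (_ : - x ^+ 2 / _ = - (x ^+ 2 / 4)); last by rewrite -mulrnA mulNr.
    by field.
  rewrite mulrCA ler_wpM2l ?normal_peak_ge0//.
  rewrite (_ : - (x ^+ 2 / 2) = - (x ^+ 2 / 4) + - (x ^+ 2 / 4)); last by field.
  rewrite expRD mulrA ler_wpM2r ?expR_ge0// expRN ler_pdivrMr ?expR_gt0//.
  have h1 := expR_ge1Dx (x ^+ 2 / 4).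
  have h2 : 0 <= (`|x| / 2 - 1) ^+ 2 by exact: sqr_ge0.
  by rewrite -[x ^+ 2]real_normK ?num_real// in h1 *; nra.
- by apply: integrableZl => //; exact: integrable_normal_pdf.
Qed.

(** Stein's identity: the derivative of sin (t x + c) p(x) integrates to 0, as this product vanishes
    at both infinities. *)
Let expect_stein t c :
  \int[mu]_x (- x * sin (t * x + c) * p x) = - t * \int[mu]_x (cos (t * x + c) * p x).
Proof.
pose F (x : R) := sin (t * x + c) * p x.
pose f x := t * (cos (t * x + c) * p x) + - x * sin (t * x + c) * p x.
have dF (x : R) : is_derive x 1 F (f x).
  have h := is_derive_mul (is_derive_comp (is_derive_sin _) (is_derive_affine t c x)) (is_derive_p x).
  by apply: (@is_derive_eq _ _ _ _ _ _ _ _ h); rewrite /f; ring.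
have cp : continuous p by apply: continuous_normal_pdf; rewrite oner_eq0.
have caff : continuous (fun x : R => t * x + c).
  move=> x; apply: cvgD; last exact: cvg_cst.
  by apply: cvgM; [exact: cvg_cst|exact: cvg_id].
have ccos : continuous (fun x => cos (t * x + c)).
  by move=> x; apply: (continuous_comp (@caff x)); exact: continuous_cos.
have csin : continuous (fun x => sin (t * x + c)).
  by move=> x; apply: (continuous_comp (@caff x)); exact: continuous_sin.
have cf : continuous f.
  move=> x; apply: cvgD.
    by apply: cvgM; [exact: cvg_cst|apply: cvgM; [exact: ccos|exact: cp]].
  apply: cvgM; last exact: cp.
  by apply: cvgM; [apply: cvgN; exact: cvg_id|exact: csin].
have mf : measurable_fun setT f by exact: continuous_measurable_fun.
have int1 : mu.-integrable setT (EFin \o (fun x => cos (t * x + c) * p x)).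
  apply: (@le_integrable _ _ _ mu setT measurableT _ (EFin \o p)) => //.
    apply/measurable_EFinP; apply: measurable_funM => //.
    exact: continuous_measurable_fun.
  by move=> x _; rewrite /= lee_fin normrM ler_piMl// cos_max.
have int2 : mu.-integrable setT (EFin \o (fun x => - x * sin (t * x + c) * p x)).
  apply: (@le_integrable _ _ _ mu setT measurableT _ (EFin \o (fun x => `|x| * p x))) => //.
    apply/measurable_EFinP; apply: measurable_funM => //.
    apply: continuous_measurable_fun => x; apply: cvgM; last exact: csin.
    by apply: cvgN; exact: cvg_id.
  move=> x _; rewrite /= lee_fin normrM normrM normrN [leRHS]normrM normr_id.
  by rewrite ler_wpM2r// ler_piMr// sin_max.
have int1t : mu.-integrable setT (EFin \o (fun x => t * (cos (t * x + c) * p x))).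
  rewrite (_ : _ \o _ = fun x => t%:E * (cos (t * x + c) * p x)%:E)%E//.
  exact: integrableZl.
have intf : mu.-integrable setT (EFin \o f) by exact: (integrableD measurableT int1t int2).
suff : \int[mu]_x f x = 0.
  rewrite /f RintegralD// RintegralZl// => /eqP.
  by rewrite addrC addr_eq0 => /eqP ->; rewrite mulNr.
(* The integral over the line is the limit of the integrals over [-(n + 1), n + 1], each given by
   the boundary values of [F]. *)
have ftc n : \int[mu]_(x in `[- n.+1%:R, n.+1%:R]) f x = F n.+1%:R - F (- n.+1%:R).
  rewrite /Rintegral (@continuous_FTC2 _ f F)//.
  - by have := ltr0Sn R n; lra.
  - exact: continuous_subspaceT.
  - have cF : continuous F by move=> x; apply: cvgM; [exact: csin|exact: cp].
    split.
    + by move=> x _; exact: ex_derive.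
    + by apply: cvg_at_right_filter; exact: cF.
    + by apply: cvg_at_left_filter; exact: cF.
  - by move=> x _; rewrite derive1E; exact: derive_val.
(* At y = n + 1, exp(y^2 / 2) >= 1 + y^2 / 2 >= y bounds the density by a multiple of 1 / (n +
   1). *)
have p_cvg0 : p n.+1%:R @[n --> \oo] --> (0 : R).
  apply: (squeeze_cvgr (f := cst 0) (h := fun n => normal_peak 1 * @harmonic R n)); last 2 first.
  - exact: cvg_cst.
  - by rewrite -(mulr0 (normal_peak (1 : R))); apply: cvgM; [exact: cvg_cst|exact: cvg_harmonic].
  apply: nearW => n; rewrite p0/= pE ler_wpM2l ?normal_peak_ge0// expRN lef_pV2 ?posrE ?expR_gt0//.
  have h1 := expR_ge1Dx ((n.+1%:R : R) ^+ 2 / 2).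
  have h2 : 0 <= ((n.+1%:R : R) - 1) ^+ 2 by exact: sqr_ge0.
  by nra.
have pN x : p (- x) = p x by rewrite !pE sqrrN.
have lim0 : F n.+1%:R - F (- n.+1%:R) @[n --> \oo] --> (0 : R).
  apply: norm_cvg0.
  apply: (squeeze_cvgr (f := cst 0) (h := fun n => p n.+1%:R + p n.+1%:R)); last 2 first.
  - exact: cvg_cst.
  - by rewrite -[X in _ --> X]addr0; exact: cvgD.
  apply: nearW => n; rewrite normr_ge0/= (le_trans (ler_normB _ _))// /F pN.
  by rewrite !normrM (ger0_norm (p0 _)) lerD// ler_piMl// sin_max.
have lim1 : \int[mu]_(x in `[- n.+1%:R, n.+1%:R]) f x @[n --> \oo] --> \int[mu]_x f x.
  under eq_fun do rewrite Rintegral_mkcond.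
  have mI n : measurable (`[- n.+1%:R, n.+1%:R]%classic : set R) by exact: measurable_itv.
  have [] := @dominated_convergence _ _ _ mu setT measurableT
    (fun n => EFin \o (f \_ `[- n.+1%:R, n.+1%:R])) (EFin \o f) (EFin \o (fun x => `|f x|)).
  - by move=> n; apply/measurable_EFinP/measurable_restrict => //; rewrite setTI; exact: measurable_funTS.
  - exact/measurable_EFinP.
  - apply: aeW => x _; apply: cvg_near_cst; near=> n.
    rewrite /= patchE ifT//; apply/mem_set; rewrite /= in_itv/= -ler_norml.
    have h : `|x| <= n%:R by near: n; exact: nbhs_infty_ger.
    by rewrite (le_trans h)// ler_nat.
  - exact: (integrable_norm intf).
  - apply: aeW => x n _; rewrite /= lee_fin patchE; case: ifP => // _.
    by rewrite normr0.
  move=> _ _ h; apply: fine_cvg.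
  by rewrite fineK//; exact: integrable_fin_num.
have e : (fun n => F n.+1%:R - F (- n.+1%:R)) =
    (fun n => \int[mu]_(x in `[- n.+1%:R, n.+1%:R]) f x).
  by apply/funext => n; rewrite ftc.
rewrite e in lim0; exact: (cvg_unique _ lim1 lim0).
Unshelve. all: end_near. Qed.

(** As a function of [t] the left side satisfies F' = - t F, by Stein's identity, so F(t) exp(t^2 /
    2) is constant. The phase [c] absorbs a second coordinate and turns cosines into sines. *)
Lemma expect_cos_std_normal t c :
  \int[std_normal]_x cos (t * x + c) = expR (- (t ^+ 2 / 2)) * cos c.
Proof.
have mlin (s : R) : measurable_fun setT (fun x : measurableTypeR R => s * x + c).
  by apply: measurable_funD => //; exact: measurable_funM.
pose F s := \int[mu]_x (cos (s * x + c) * p x).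
have FE s : \int[std_normal]_x cos (s * x + c) = F s.
  by rewrite expect_std_normal//; exact: bmeas_comp bmeas_cos _.
have dF (s : R) : is_derive s 1 F (- s * F s).
  have h (s' x : R) : is_derive s' 1 (fun s : R => cos (s * x + c) * p x) (- x * sin (s' * x + c) * p x).
    have h1 : is_derive s' 1 (fun s : R => x * s + c) x by exact: is_derive_affine.
    have h2 := is_derive_comp (is_derive_cos _) h1.
    have h3 := is_derive_mul h2 (is_derive_cst (p x) s' 1).
    under eq_fun do rewrite (mulrC _ x).
    by apply: (@is_derive_eq _ _ _ _ _ _ _ _ h3); rewrite /cst/= (mulrC s'); ring.
  have hd s' x : partial1of2 (fun s x : R => cos (s * x + c) * p x) s' x = - x * sin (s' * x + c) * p x.
    by rewrite partial1of2E; exact: derive_val.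
  have I : `]s - 1, s + 1[%classic s by rewrite /= in_itv/=; apply/andP; split; lra.
  have if_ s' : `]s - 1, s + 1[%classic s' ->
    mu.-integrable setT (EFin \o (fun x => cos (s' * x + c) * p x)).
    move=> _; apply: (@le_integrable _ _ _ mu setT measurableT _ (EFin \o p)) => //.
      apply/measurable_EFinP; apply: measurable_funM => //.
      by apply: measurableT_comp; [exact: bmeas_cos.1|exact: mlin].
    move=> x _; rewrite /= lee_fin normrM ler_piMl// cos_max//.
  have der s' x : `]s - 1, s + 1[%classic s' -> setT x ->
    derivable ((fun s x : R => cos (s * x + c) * p x) ^~ x) s' 1 by move=> _ _; exact: ex_derive.
  have xp0 x : 0 <= `|x| * p x by rewrite mulr_ge0.
  have ub s' x : `]s - 1, s + 1[%classic s' -> setT x ->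
      `|partial1of2 (fun s x : R => cos (s * x + c) * p x) s' x| <= `|x| * p x.
    move=> _ _; rewrite hd normrM (ger0_norm (p0 x)) ler_wpM2r//.
    by rewrite normrM normrN ler_piMr// sin_max.
  apply: DeriveDef.
    exact: (derivable_under_integral measurableT I if_ der xp0 integrable_xp ub).
  rewrite -derive1E.
  rewrite (differentiation_under_integral measurableT I if_ der xp0 integrable_xp ub).
  rewrite -expect_stein; apply: eq_Rintegral => x _; exact: hd.
pose G s := F s * expR (s ^+ 2 / 2).
have dG (s : R) : is_derive s 1 G 0.
  have h1 : is_derive s 1 (fun s : R => 1 * (s ^+ 2 / 2)) (1 * s) by exact: is_derive_halfsqr.
  have h2 := is_derive_mul (dF s) (is_derive_comp (is_derive_expR _) h1).
  rewrite /G; under eq_fun do rewrite -[X in expR X]mul1r.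
  by apply: (@is_derive_eq _ _ _ _ _ _ _ _ h2); ring.
have G0 : G t = G 0 by exact: is_derive_0_is_cst.
rewrite FE.
have F0 : F 0 = cos c.
  rewrite -FE -[RHS](expect_cst std_normal).
  by apply: eq_Rintegral => x _; rewrite mul0r add0r.
move: G0; rewrite /G F0 expr0n/= mul0r expR0 mulr1 => <-.
by rewrite mulrC -mulrA -expRD subrr expR0 mulr1.
Qed.

End standard_normal.

(** * Cauchy's functional equation for nonnegative functions on an interval *)

Section additive_function.
Context {R : realType} (L : R) (a : R -> R).
Hypothesis L0 : 0 < L.
Hypothesis aD : forall x y, 0 <= x -> 0 <= y -> x + y <= L -> a (x + y) = a x + a y.
Hypothesis a0 : forall x, 0 <= x <= L -> 0 <= a x.

Let additive_natmul n x : 0 <= x -> n%:R * x <= L -> a (n%:R * x) = n%:R * a x.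
Proof.
move=> x0; elim: n => [|n ih] h.
  rewrite !mul0r; have := @aD 0 0 (lexx _) (lexx _).
  by rewrite addr0 => /(_ (ltW L0)); lra.
have nx : 0 <= n%:R * x by rewrite mulr_ge0.
have e : n.+1%:R * x = n%:R * x + x by rewrite -natr1; ring.
rewrite e in h *.
rewrite aD// ih; last by lra.
by rewrite -natr1; ring.
Qed.

(** Nonnegativity makes [a] nondecreasing, so [a x] is at least its value at the last multiple of L
    / n below [x]; this loses at most a(L) / n, which is smaller than any supposed gap [e] for large
    [n]. *)
Let additive_lower x : 0 <= x <= L -> x / L * a L <= a x.
Proof.
move=> /andP[x0 xL]; rewrite leNgt; apply/negP => h.
have aL : 0 <= a L by apply: a0; rewrite lexx ltW.
pose e := x / L * a L - a x.
have e0 : 0 < e by rewrite /e subr_gt0.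
have /archi_boundP := divr_ge0 aL (ltW e0).
set n := Num.bound _; rewrite ltr_pdivrMr// => hn.
have n0 : (0 < n)%N by rewrite lt0n; apply/eqP => n0; move: hn; rewrite n0 mul0r ltNge aL.
have nR : 0 < n%:R :> R by rewrite ltr0n.
(* The largest [k] for which k L / n is at most [x]. *)
pose k := Num.truncn (n%:R * (x / L)).
have xL01 : 0 <= x / L <= 1 by rewrite divr_ge0//= ?(ltW L0)// ler_pdivrMr// mul1r.
have /andP[k1 k2] : k%:R <= n%:R * (x / L) < k.+1%:R.
  by apply: truncn_itv; rewrite mulr_ge0//; case/andP: xL01.
have an : a L = n%:R * a (L / n%:R).
  have e' : n%:R * (L / n%:R) = L by field; rewrite gt_eqF.
  by rewrite -additive_natmul ?e'// divr_ge0// ltW.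
have kx : k%:R * (L / n%:R) <= x.
  rewrite mulrA ler_pdivrMr// -ler_pdivlMr// (le_trans k1)// le_eqVlt; apply/orP; left.
  by apply/eqP; rewrite mulrA (mulrC n%:R).
have kLn : 0 <= k%:R * (L / n%:R) by rewrite mulr_ge0// divr_ge0// ltW.
have ax : a x = k%:R * a (L / n%:R) + a (x - k%:R * (L / n%:R)).
  rewrite -additive_natmul; last 2 first.
  - by rewrite divr_ge0// ltW.
  - exact: le_trans xL.
  rewrite -aD//; [congr a; ring|lra|lra].
have ar : 0 <= a (x - k%:R * (L / n%:R)) by apply: a0; apply/andP; split; lra.
have an0 : 0 <= a (L / n%:R).
  by rewrite -(pmulr_rge0 _ nR) -an.
move: hn; rewrite /e => hn; rewrite an in hn.
rewrite -natr1 in k2.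
nra.
Qed.

(** The upper bound is the lower bound at L - x. *)
Lemma additive_linear x : 0 <= x <= L -> a x = x / L * a L.
Proof.
move=> xL; apply/eqP; rewrite eq_le additive_lower// andbT.
have /andP[x0 xL'] := xL.
have h : 0 <= L - x <= L by apply/andP; split; lra.
have := additive_lower h.
have : a L = a x + a (L - x) by rewrite -aD; [congr a; ring|lra|lra|lra].
have -> : (L - x) / L * a L = a L - x / L * a L by field; rewrite gt_eqF.
lra.
Qed.

End additive_function.

Section sign_products.
Context {R : realType} {d} {T : measurableType d} (P : probability T R).

Lemma expect_eq0_ae (f : T -> R) : bmeas f -> (forall w, 0 <= f w) ->
  \int[P]_w f w = 0 -> {ae P, forall w, f w = 0}.
Proof.
move=> bf f0 Ef; have mf : measurable_fun setT (EFin \o f) by apply/measurable_EFinP; exact: bf.1.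
have : (\int[P]_w `|(EFin \o f) w| = 0)%E.
  rewrite -[RHS](congr1 EFin Ef) -EFin_Rintegral//.
  by apply: eq_integral => w _; rewrite /= ger0_norm.
move/(ae_eq_integral_abs P measurableT mf) => h.
by apply: filterS h => w hw; apply: EFin_inj; exact: hw.
Qed.

(** 1 - sg(x)^2 is nonnegative with expectation 0, and it equals 1 wherever [x] vanishes. *)
Lemma ae_neq0_sgr (x : T -> R) : measurable_fun setT x ->
  \int[P]_w (Num.sg (x w) * Num.sg (x w)) = 1 -> {ae P, forall w, x w != 0}.
Proof.
move=> mx E1.
have bs : bmeas (fun w => Num.sg (x w)) by exact: bmeas_comp bmeas_sgr mx.
have : {ae P, forall w, 1 - Num.sg (x w) * Num.sg (x w) = 0}.
  apply: expect_eq0_ae.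
  - by apply: bmeasB; [exact: bmeas_cst|exact: bmeasM].
  - by move=> w; case: sgrP => _; rewrite ?mulr0 ?mulr1 ?mulrNN ?mulr1; lra.
  - rewrite expectB; [|exact: bmeas_cst|exact: bmeasM].
    by rewrite expect_cst E1 subrr.
apply: filterS => w; apply: contraPneq => ->.
by rewrite sgr0 mulr0 subr0; apply/eqP; rewrite oner_eq0.
Qed.

End sign_products.

(** * Rotation invariance and the angle formula for planar Gaussians *)

Section planar_normal.
Context {R : realType}.

Definition planar_normal : probability (measurableTypeR R * measurableTypeR R)%type R :=
  (@std_normal R \x @std_normal R)%E.

Lemma measurable_planar_linear (a b : R) : measurable_fun setT
  (fun z : measurableTypeR R * measurableTypeR R => a * z.1 + b * z.2).
Proof.
by apply: measurable_funD; apply: measurable_funM => //.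
Qed.

Lemma expect_cos_planar_normal (a b c : R) :
  \int[planar_normal]_z cos (a * z.1 + b * z.2 + c) =
  expR (- ((a ^+ 2 + b ^+ 2) / 2)) * cos c.
Proof.
rewrite /planar_normal expect_prod; last first.
  apply: bmeas_comp bmeas_cos _; apply: measurable_funD => //.
  exact: measurable_planar_linear.
transitivity (\int[@std_normal R]_x (expR (- (b ^+ 2 / 2)) * cos (a * x + c))).
  apply: eq_Rintegral => x _ /=.
  rewrite -expect_cos_std_normal; apply: eq_Rintegral => y _.
  by congr cos; ring.
have mlin : measurable_fun setT (fun x : measurableTypeR R => a * x + c).
  by apply: measurable_funD => //; exact: measurable_funM.
rewrite expectZ; last exact: bmeas_comp bmeas_cos mlin.
rewrite expect_cos_std_normal mulrA -expRD; congr (expR _ * _).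
by field.
Qed.

Lemma expect_sin_planar_normal (a b : R) :
  \int[planar_normal]_z sin (a * z.1 + b * z.2) = 0.
Proof.
transitivity (\int[planar_normal]_z cos (a * z.1 + b * z.2 + - (pi / 2))).
  by apply: eq_Rintegral => z _; rewrite cosBpihalf.
by rewrite expect_cos_planar_normal cosN cos_pihalf mulr0.
Qed.

(** Coordinate of the Gaussian point along the unit vector of angle [t]. *)
Let xi (t : R) (z : measurableTypeR R * measurableTypeR R) : R :=
  cos t * z.1 + sin t * z.2.

Let mxi t : measurable_fun setT (xi t).
Proof. exact: measurable_planar_linear. Qed.

Let angle_corr (t : R) := \int[planar_normal]_z (Num.sg (xi 0 z) * Num.sg (xi t z)).

(** The characteristic function of two such coordinates depends on the angles only through cos (t2 -
    t1). *)
Let rotation_invariance t1 t2 :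
  \int[planar_normal]_z (Num.sg (xi t1 z) * Num.sg (xi t2 z)) = angle_corr (t2 - t1).
Proof.
have lin s t u1 u2 z : s * xi u1 z + t * xi u2 z =
    (s * cos u1 + t * cos u2) * z.1 + (s * sin u1 + t * sin u2) * z.2.
  by rewrite /xi; ring.
apply: expect_sgrM_eq => // s t.
- under eq_Rintegral do rewrite lin -[X in cos X]addr0.
  under [RHS]eq_Rintegral do rewrite lin -[X in cos X]addr0.
  rewrite !expect_cos_planar_normal; congr (expR _ * _); congr (- (_ / 2)).
  rewrite cosB sinB cos0 sin0.
  have h1 := cos2Dsin2 t1; have h2 := cos2Dsin2 t2.
  set c1 := cos t1 in h1 *; set s1 := sin t1 in h1 *.
  set c2 := cos t2 in h2 *; set s2 := sin t2 in h2 *.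
  transitivity (s ^+ 2 * (c1 ^+ 2 + s1 ^+ 2) + t ^+ 2 * (c2 ^+ 2 + s2 ^+ 2) +
    2 * s * t * (c1 * c2 + s1 * s2)); first by ring.
  rewrite h1 h2.
  (* Once the difference of angles is expanded, its squared cosine and sine add up to this product,
     by the two-square identity. *)
  transitivity (s ^+ 2 + t ^+ 2 * ((c1 ^+ 2 + s1 ^+ 2) * (c2 ^+ 2 + s2 ^+ 2)) +
    2 * s * t * (c1 * c2 + s1 * s2)); first by rewrite h1 h2; ring.
  by ring.
- under eq_Rintegral do rewrite lin.
  under [RHS]eq_Rintegral do rewrite lin.
  by rewrite !expect_sin_planar_normal.
Qed.

Let xi0 z : xi 0 z = z.1.
Proof. by rewrite /xi cos0 sin0 mul1r mul0r addr0. Qed.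

Let angle_corr0 : angle_corr 0 = 1.
Proof.
rewrite /angle_corr; under eq_Rintegral do rewrite xi0.
rewrite /planar_normal expect_prod; last first.
  by apply: bmeasM; apply: bmeas_comp bmeas_sgr _.
transitivity (\int[@std_normal R]_x (Num.sg x * Num.sg x)).
  apply: eq_Rintegral => x _ /=; exact: (expect_cst (@std_normal R)).
rewrite -[RHS](expect_cst (@std_normal R)); apply: ae_eq_expect => //.
  by apply: measurable_funM; exact: measurable_sgr.
have h : {ae @std_normal R, forall x : measurableTypeR R, x != 0}.
  exists [set 0]; split; first exact: measurable_set1.
  - have dom : normal_prob 0 1 `<< (@lebesgue_measure R) by exact: normal_prob_dominates.
    have /null_content_dominatesP := dom; apply => //.
    exact: lebesgue_measure_set1.
  - by move=> x /=; rewrite /= => /negP; rewrite negbK => /eqP.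
by apply: filterS h => x /=; case: sgrP; rewrite ?mulr1 ?mulrNN ?mulr1.
Qed.

(** Rotation invariance reduces E sg(xi t)^2 to direction 0, where it is 1. *)
Lemma xi_neq0 t : {ae planar_normal, forall z, xi t z != 0}.
Proof.
apply: ae_neq0_sgr => //.
by rewrite rotation_invariance subrr angle_corr0.
Qed.

Let bxi t u : bmeas (fun z => Num.sg (xi t z) * Num.sg (xi u z)).
Proof. by apply: bmeasM; exact: bmeas_comp bmeas_sgr _. Qed.

(** 1 - [angle_corr] is twice the probability of a sign change. On an arc of length at most pi the
    sign of [xi] changes at most once, so the sign changes over the two sub-arcs add up pointwise,
    off a null set. *)
Let angle_additive t1 t2 : 0 <= t1 -> 0 <= t2 -> t1 + t2 <= pi ->
  1 - angle_corr (t1 + t2) = (1 - angle_corr t1) + (1 - angle_corr t2).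
Proof.
move=> t10 t20 t12.
have -> : angle_corr t2 = angle_corr ((t1 + t2) - t1) by congr angle_corr; ring.
rewrite -(rotation_invariance t1 (t1 + t2)) /angle_corr.
have b1 := bmeas_cst (1 : R).
have bB t u := bmeasB (b1 _ _) (bxi t u).
have EB t u : 1 - \int[planar_normal]_z (Num.sg (xi t z) * Num.sg (xi u z)) =
    \int[planar_normal]_z (1 - Num.sg (xi t z) * Num.sg (xi u z)).
  by rewrite expectB// expect_cst.
rewrite !EB -expectD//.
apply: ae_eq_expect; [exact: (bB _ _).1|exact: (bmeasD (bB _ _) (bB _ _)).1|].
have := xi_neq0 0; have := xi_neq0 t1; have := xi_neq0 (t1 + t2).
apply: filterS3 => z n2 n1 n0.
(* The middle coordinate is a nonnegative combination of the outer ones: if these share a sign, it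
   has that sign too. *)
have key : xi t1 z * sin (t1 + t2) = xi 0 z * sin t2 + xi (t1 + t2) z * sin t1.
  rewrite /xi cosD sinD cos0 sin0.
  have h1 := cos2Dsin2 t1; have h2 := cos2Dsin2 t2.
  transitivity (sin t1 * cos t2 * (cos t1 * z.1 + sin t1 * z.2) +
    cos t1 ^+ 2 * sin t2 * z.1 + cos t1 * sin t1 * sin t2 * z.2); first by ring.
  rewrite (_ : cos t1 ^+ 2 = 1 - sin t1 ^+ 2); last by rewrite -h1; ring.
  by ring.
have s1 : 0 <= sin t1 by apply: sin_ge0_pi; rewrite t10/=; lra.
have s2 : 0 <= sin t2 by apply: sin_ge0_pi; rewrite t20/=; lra.
(* At total angle pi or 0 the factor sin (t1 + t2) vanishes and [key] says nothing; there the outer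
   coordinates are opposite or equal. *)
have [e|] := eqVneq (t1 + t2) pi.
  have -> : xi (t1 + t2) z = - xi 0 z by rewrite e /xi cospi sinpi cos0 sin0; ring.
  by rewrite sgrN; case: (sgrP (xi 0 z)) n0 => // _ _; ring.
move=> npi; have [e|n00] := eqVneq (t1 + t2) 0.
  have -> : t1 = 0 by lra.
  have -> : t2 = 0 by lra.
  by rewrite addr0; case: (sgrP (xi 0 z)) n0 => // _ _; ring.
have s12 : 0 < sin (t1 + t2).
  by apply: sin_gt0_pi; rewrite lt_neqAle eq_sym n00 addr_ge0//= lt_neqAle npi t12.
case: (sgrP (xi 0 z)) n0 => // p0 _.
- case: (sgrP (xi (t1 + t2) z)) n2 => // p2 _.
  + have : 0 <= xi t1 z * sin (t1 + t2) by rewrite key addr_ge0// mulr_ge0// ltW.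
    rewrite pmulr_lge0// => p1; rewrite gtr0_sg; last by rewrite lt_neqAle eq_sym n1.
    by ring.
  + by ring.
- case: (sgrP (xi (t1 + t2) z)) n2 => // p2 _.
  + by ring.
  + have : xi t1 z * sin (t1 + t2) <= 0.
      by rewrite key -oppr_ge0 opprD addr_ge0// -mulNr mulr_ge0// oppr_ge0 ltW.
    rewrite pmulr_lle0// => p1; rewrite ltr0_sg; last by rewrite lt_neqAle n1.
    by ring.
Qed.

(** 1 - [angle_corr] is additive and nonnegative on [0, pi], hence linear, and its value at pi is 2
    because directions 0 and pi are opposite. *)
Lemma expect_sgr_planar_normal (t : R) : 0 <= t <= pi ->
  \int[planar_normal]_z (Num.sg z.1 * Num.sg (cos t * z.1 + sin t * z.2)) =
  1 - 2 * (t / pi).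
Proof.
move=> t0pi.
have -> : \int[planar_normal]_z (Num.sg z.1 * Num.sg (cos t * z.1 + sin t * z.2)) = angle_corr t.
  by apply: eq_Rintegral => z _; rewrite xi0.
have corr_le1 u : angle_corr u <= 1.
  rewrite -[leRHS](expect_cst planar_normal); apply: le_expect => //; first exact: bmeas_cst.
  by move=> z; case: sgrP => _; case: sgrP => _; lra.
have corr_pi : angle_corr pi = - 1.
  rewrite -angle_corr0 /angle_corr -[RHS]mulN1r -expectZ//.
  apply: eq_Rintegral => z _.
  rewrite (_ : xi pi z = - xi 0 z); first by rewrite sgrN mulrN mulN1r.
  by rewrite /xi cospi sinpi cos0 sin0; ring.
have := @additive_linear R pi (fun u => 1 - angle_corr u) (pi_gt0 R) _ _ t t0pi.
rewrite corr_pi => h.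
have : 1 - angle_corr t = t / pi * (1 - -1).
  by apply: h => [x y|x _]; [exact: angle_additive|rewrite subr_ge0].
by lra.
Qed.

End planar_normal.

(** * The sign correlation of a stable pair *)

Section measurability.
Context {R : realType}.

Lemma measurable_acos : measurable_fun setT (@acos R).
Proof.
(* Outside [-1, 1] no angle has cosine [x], so [acos] is the default choice from an empty set, the
   same value as at 2. *)
have oob (x : R) : ~ (-1 <= x <= 1) -> acos x = acos 2.
  move=> nx; rewrite acos.unlock; congr get; apply/seteqP; split => y /= [_ cy].
    by case: nx; rewrite -cy cos_geN1 cos_le1.
  by have := cos_le1 y; rewrite cy => h; exfalso; lra.
pose O : set R := `]-1, 1[%classic.
pose N : set R := ~` `[-1, 1]%classic.
have mO : measurable O by exact: measurable_itv.
have mN : measurable N by apply: measurableC; exact: measurable_itv.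
rewrite (_ : setT = O `|` ([set 1] `|` ([set -1] `|` N))); last first.
  apply/esym/seteqP; split => // x _.
  have [x1|x1] := eqVneq x 1; first by right; left.
  have [x2|x2] := eqVneq x (-1); first by right; right; left.
  have [xi|nxi] := boolP (x \in `[-1, 1]); last by right; right; right; apply/negP.
  left; move: xi; rewrite /O /= !in_itv/= => /andP[h1 h2].
  by rewrite lt_neqAle eq_sym x2 h1/= lt_neqAle x1.
apply/measurable_funU => //; first by do 2 apply: measurableU => //.
split.
  apply: open_continuous_measurable_fun; first exact: interval_open.
  by move=> x; rewrite inE /O /= in_itv/= => /continuous_acos.
apply/measurable_funU => //; first exact: measurableU.
split; first exact: measurable_fun_set1.
apply/measurable_funU => //.
split; first exact: measurable_fun_set1.
apply: (eq_measurable_fun (cst (acos 2))) => [x|]; last exact: measurable_cst.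
by rewrite inE /N /= in_itv/= => /oob ->.
Qed.

Lemma measurable_div_sqrt {d} {T : measurableType d} (f g : T -> R) :
  measurable_fun setT f -> measurable_fun setT g ->
  measurable_fun setT (fun w => f w / Num.sqrt (g w)).
Proof.
move=> mf mg; apply: measurable_funM => //.
rewrite (_ : (fun w => _) = fun w => (Num.sqrt (g w)) `^ (-1)).
  apply: (@measurableT_comp _ _ _ _ _ _ (fun x => x `^ (-1))) => //.
  apply: measurableT_comp => //; apply: continuous_measurable_fun.
  exact: sqrt_continuous.
by apply/funext => w; rewrite powR_inv1// sqrtr_ge0.
Qed.

End measurability.

(** * The cosine of two weighted vectors *)

Section quadratic_form.
Context {R : realType} {D : nat} (u v S : 'I_D -> R).

(** For positive [S], the cosine of the angle between the vectors with entries u_i sqrt(S_i) and v_i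
    sqrt(S_i). *)
Definition cosine := (\sum_(i < D) u i * v i * S i) /
  Num.sqrt ((\sum_(i < D) u i ^+ 2 * S i) * (\sum_(i < D) v i ^+ 2 * S i)).

Local Notation A := (\sum_(i < D) u i ^+ 2 * S i).
Local Notation B := (\sum_(i < D) v i ^+ 2 * S i).
Local Notation C := (\sum_(i < D) u i * v i * S i).

Lemma sum_sqr_linear (s t : R) : \sum_(i < D) (s * u i + t * v i) ^+ 2 * S i =
  s ^+ 2 * A + 2 * s * t * C + t ^+ 2 * B.
Proof.
by rewrite !mulr_sumr -!big_split/=; apply: eq_bigr => i _; ring.
Qed.

Lemma sum_sqr_gt0 (f : 'I_D -> R) : (forall i, 0 < S i) -> (exists i, 0 < f i) ->
  0 < \sum_(i < D) f i ^+ 2 * S i.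
Proof.
move=> S0 [j fj]; rewrite (bigD1 j)//= ltr_pwDl//.
  by rewrite mulr_gt0// exprn_gt0.
by apply: sumr_ge0 => i _; rewrite mulr_ge0 ?sqr_ge0// ltW.
Qed.

Hypothesis u0 : forall i, 0 <= u i.
Hypothesis v0 : forall i, 0 <= v i.
Hypothesis S0 : forall i, 0 < S i.
Hypothesis u1 : exists i, 0 < u i.
Hypothesis v1 : exists i, 0 < v i.

Lemma cosineE : Num.sqrt A * Num.sqrt B * cosine = C.
Proof.
have A0 := sum_sqr_gt0 S0 u1; have B0 := sum_sqr_gt0 S0 v1.
rewrite /cosine -sqrtrM ?ltW// mulrC divfK// gt_eqF// sqrtr_gt0 mulr_gt0//.
Qed.

Lemma cosine_ge0 : 0 <= cosine.
Proof.
by rewrite divr_ge0 ?sqrtr_ge0// sumr_ge0// => i _; rewrite !mulr_ge0// ltW.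
Qed.

Lemma cosine_le1 : cosine <= 1.
Proof.
have A0 := sum_sqr_gt0 S0 u1; have B0 := sum_sqr_gt0 S0 v1.
have C0 : 0 <= C by rewrite sumr_ge0// => i _; rewrite !mulr_ge0// ltW.
have AB0 : 0 < A * B by rewrite mulr_gt0.
rewrite ler_pdivrMr ?sqrtr_gt0// mul1r -[leLHS]ger0_norm// -sqrtr_sqr ler_wsqrtr//.
(* Cauchy-Schwarz by evaluating the form at (B, -C), where it equals B (A B - C^2). *)
have : 0 <= \sum_(i < D) (B * u i + - C * v i) ^+ 2 * S i.
  by apply: sumr_ge0 => i _; rewrite mulr_ge0 ?sqr_ge0// ltW.
rewrite sum_sqr_linear (_ : _ + _ = B * (A * B - C ^+ 2)); last by ring.
by rewrite pmulr_rge0// subr_ge0.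
Qed.

End quadratic_form.

(** * The Gaussian mixture and the probability of a sign change *)

Section sign_correlation.
Context {R : realType} {alpha : R} {D : nat}
  {d1} {Omega1 : measurableType d1} (P1 : probability Omega1 R)
  {d2} {Omega2 : measurableType d2} (P2 : probability Omega2 R)
  (r : 'I_D -> Omega1 -> R) (S : 'I_D -> Omega2 -> R).
Hypothesis mr : forall i, measurable_fun setT (r i).
Hypothesis mS : forall i, measurable_fun setT (S i).
Hypothesis S0 : forall i w, 0 < S i w.
Hypothesis cos_r : forall a : 'I_D -> R,
  \int[P1]_w cos (\sum_i a i * r i w) = expR (- \sum_i `|a i| `^ alpha).
Hypothesis sin_r : forall a : 'I_D -> R, \int[P1]_w sin (\sum_i a i * r i w) = 0.
Hypothesis laplace_S : forall s : 'I_D -> R, (forall i, 0 <= s i) ->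
  \int[P2]_w expR (- \sum_i s i * S i w) = expR (- \sum_i s i `^ (alpha / 2)).

Lemma measurable_cosine (u v : 'I_D -> R) :
  measurable_fun setT (fun w => cosine u v (S ^~ w)).
Proof.
apply: measurable_div_sqrt; last apply: measurable_funM;
  by apply: measurable_sum => i; apply: measurable_funM.
Qed.

Lemma bmeas_acos_cosine (u v : 'I_D -> R) :
  (forall i, 0 <= u i) -> (forall i, 0 <= v i) ->
  (exists i, 0 < u i) -> (exists i, 0 < v i) ->
  bmeas (fun w => acos (cosine u v (S ^~ w))).
Proof.
move=> u0 v0 u1 v1; split.
  by apply: measurableT_comp; [exact: measurable_acos|exact: measurable_cosine].
exists pi => w; have c0 : 0 <= cosine u v (S ^~ w) by exact: cosine_ge0.
have c1 : cosine u v (S ^~ w) <= 1 by exact: cosine_le1.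
have c11 : -1 <= cosine u v (S ^~ w) <= 1 by apply/andP; split; lra.
by rewrite ger0_norm ?acos_ge0// acos_lepi.
Qed.

Section pair.
Variables u v : 'I_D -> R.
Hypothesis u0 : forall i, 0 <= u i.
Hypothesis v0 : forall i, 0 <= v i.
Hypothesis u1 : exists i, 0 < u i.
Hypothesis v1 : exists i, 0 < v i.

Let A w := \sum_(i < D) u i ^+ 2 * S i w.
Let B w := \sum_(i < D) v i ^+ 2 * S i w.
Let c w := cosine u v (S ^~ w).

Let A0 w : 0 < A w. Proof. exact: sum_sqr_gt0. Qed.
Let B0 w : 0 < B w. Proof. exact: sum_sqr_gt0. Qed.
Let c01 w : 0 <= c w <= 1.
Proof. by rewrite cosine_ge0// cosine_le1. Qed.
Let c1 w : -1 <= c w <= 1.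
Proof. by have /andP[] := c01 w; lra. Qed.

Let plane := (measurableTypeR R * measurableTypeR R)%type.

(* Conditionally on [S], a centred Gaussian pair whose covariance matrix is
   twice the Gram matrix of the vectors [u i * sqrt (S i)], [v i * sqrt (S i)]. *)
Let X (z : Omega2 * plane) : R := Num.sqrt (2 * A z.1) * z.2.1.
Let Y (z : Omega2 * plane) : R := Num.sqrt (2 * B z.1) *
  (c z.1 * z.2.1 + Num.sqrt (1 - c z.1 ^+ 2) * z.2.2).

Let mA : measurable_fun setT A.
Proof. by apply: measurable_sum => i; exact: measurable_funM. Qed.
Let mB : measurable_fun setT B.
Proof. by apply: measurable_sum => i; exact: measurable_funM. Qed.
Let mc : measurable_fun setT c.
Proof. exact: measurable_cosine. Qed.

Let measurable_sqrtr (f : Omega2 -> R) : measurable_fun setT f ->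
  measurable_fun setT (fun w => Num.sqrt (f w)).
Proof.
move=> mf; apply: measurableT_comp => //; apply: continuous_measurable_fun.
exact: sqrt_continuous.
Qed.

Let mfst (f : Omega2 -> R) : measurable_fun setT f ->
  measurable_fun setT (fun z : Omega2 * plane => f z.1).
Proof. by move=> mf; exact: measurableT_comp. Qed.

Let m21 : measurable_fun setT (fun z : Omega2 * plane => (z.2.1 : R)).
Proof. by apply: (measurableT_comp (f := fst)). Qed.

Let m22 : measurable_fun setT (fun z : Omega2 * plane => (z.2.2 : R)).
Proof. by apply: (measurableT_comp (f := snd)). Qed.

Let mX : measurable_fun setT X.
Proof.
apply: measurable_funM => //.
apply: (mfst (f := fun w => Num.sqrt (2 * A w))); apply: measurable_sqrtr.
exact: measurable_funM.
Qed.

Let mY : measurable_fun setT Y.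
Proof.
apply: measurable_funM.
  apply: (mfst (f := fun w => Num.sqrt (2 * B w))); apply: measurable_sqrtr.
  exact: measurable_funM.
apply: measurable_funD; apply: measurable_funM => //.
  exact: mfst.
apply: (mfst (f := fun w => Num.sqrt (1 - c w ^+ 2))); apply: measurable_sqrtr.
by apply: measurable_funB => //; exact: measurable_funX.
Qed.

Let linXY s t w (z : plane) : s * X (w, z) + t * Y (w, z) =
  (s * Num.sqrt (2 * A w) + t * Num.sqrt (2 * B w) * c w) * z.1 +
  (t * Num.sqrt (2 * B w) * Num.sqrt (1 - c w ^+ 2)) * z.2.
Proof. by rewrite /X /Y /=; ring. Qed.

Let mlinXY s t : measurable_fun setT (fun z => s * X z + t * Y z).
Proof. by apply: measurable_funD; exact: measurable_funM. Qed.

(** Given [S], the doubled variances cancel the 1/2 of the Gaussian exponent and leave exp(- sum (s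
    u_i + t v_i)^2 S_i); the Laplace transform turns each square into its power alpha / 2. *)
Let cosXY s t :
  \int[(P2 \x @planar_normal R)%E]_z cos (s * X z + t * Y z) =
  expR (- \sum_i `|s * u i + t * v i| `^ alpha).
Proof.
rewrite expect_prod; last exact: bmeas_comp bmeas_cos (mlinXY s t).
transitivity (\int[P2]_w expR (- \sum_i (s * u i + t * v i) ^+ 2 * S i w)).
  apply: eq_Rintegral => w _.
  under eq_Rintegral do rewrite linXY -[X in cos X]addr0.
  rewrite expect_cos_planar_normal cos0 mulr1; congr (expR (- _)).
  rewrite sum_sqr_linear -(@cosineE _ _ u v (S ^~ w)) // -/(A w) -/(B w) -/(c w).
  rewrite !sqrtrM//.
  set k := Num.sqrt 2; set a := Num.sqrt (A w); set b := Num.sqrt (B w).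
  set e := Num.sqrt (1 - c w ^+ 2).
  have k2 : k ^+ 2 = 2 by rewrite sqr_sqrtr.
  have a2 : a ^+ 2 = A w by rewrite sqr_sqrtr// ltW.
  have b2 : b ^+ 2 = B w by rewrite sqr_sqrtr// ltW.
  have e2 : e ^+ 2 = 1 - c w ^+ 2.
    by rewrite sqr_sqrtr// subr_ge0; have /andP[h1 h2] := c01 w; rewrite expr_le1.
  rewrite -a2 -b2.
  transitivity (k ^+ 2 / 2 * (s ^+ 2 * a ^+ 2 + 2 * s * t * (a * b * c w) +
    t ^+ 2 * b ^+ 2 * (c w ^+ 2 + e ^+ 2))); first by field.
  by rewrite k2 e2; field.
rewrite laplace_S; last by move=> i; exact: sqr_ge0.
congr (expR (- _)); apply: eq_bigr => i _.
rewrite -real_normK ?num_real// -powR_mulrn// -powRrM; congr powR.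
by field.
Qed.

Let sinXY s t : \int[(P2 \x @planar_normal R)%E]_z sin (s * X z + t * Y z) = 0.
Proof.
rewrite expect_prod; last exact: bmeas_comp bmeas_sin (mlinXY s t).
rewrite -[RHS](expect_cst P2); apply: eq_Rintegral => w _.
under eq_Rintegral do rewrite linXY.
exact: expect_sin_planar_normal.
Qed.

(** The positive factors of [X] and [Y] drop out of the signs, leaving the planar pair at angle acos
    c, whose sine is sqrt(1 - c^2). *)
Lemma expect_sgr_stable :
  \int[P1]_w (Num.sg (\sum_i u i * r i w) * Num.sg (\sum_i v i * r i w)) =
  \int[P2]_w (1 - 2 * (acos (cosine u v (S ^~ w)) / pi)).
Proof.
have mx (f : 'I_D -> R) : measurable_fun setT (fun w => \sum_i f i * r i w).
  by apply: measurable_sum => i; exact: measurable_funM.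
have lin s t w : s * (\sum_i u i * r i w) + t * (\sum_i v i * r i w) =
    \sum_i (s * u i + t * v i) * r i w.
  by rewrite !mulr_sumr -big_split/=; apply: eq_bigr => i _; ring.
transitivity (\int[(P2 \x @planar_normal R)%E]_z (Num.sg (X z) * Num.sg (Y z))).
  apply: expect_sgrM_eq => // s t.
  - by rewrite cosXY -cos_r; under eq_Rintegral do rewrite lin.
  - by rewrite sinXY; under eq_Rintegral do rewrite lin; rewrite sin_r.
rewrite expect_prod; last by apply: bmeasM; exact: bmeas_comp bmeas_sgr _.
apply: eq_Rintegral => w _.
rewrite -(@expect_sgr_planar_normal R (acos (c w))); last first.
  by rewrite acos_ge0// acos_lepi.
apply: eq_Rintegral => z _; rewrite acosK ?in_itv//= sin_acos// /X /Y/=.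
have sA : 0 < Num.sqrt (2 * A w) by rewrite sqrtr_gt0 mulr_gt0.
have sB : 0 < Num.sqrt (2 * B w) by rewrite sqrtr_gt0 mulr_gt0.
by rewrite !sgrM (gtr0_sg sA) (gtr0_sg sB) !mul1r.
Qed.

End pair.

Lemma probability_sgr_neq (u v : 'I_D -> R) :
  (forall i, 0 <= u i) -> (forall i, 0 <= v i) ->
  (exists i, 0 < u i) -> (exists i, 0 < v i) ->
  P1 [set w | Num.sg (\sum_i u i * r i w) != Num.sg (\sum_i v i * r i w)] =
  (\int[P2]_w (acos (cosine u v (S ^~ w)) / pi))%:E.
Proof.
move=> u0 v0 u1 v1.
have mx (f : 'I_D -> R) : measurable_fun setT (fun w => \sum_i f i * r i w).
  by apply: measurable_sum => i; exact: measurable_funM.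
(* The pair formed twice from [f] has cosine 1, so its sign correlation is 1 and the sum is almost
   surely nonzero. *)
have neq0 (f : 'I_D -> R) : (forall i, 0 <= f i) -> (exists i, 0 < f i) ->
    {ae P1, forall w, \sum_i f i * r i w != 0}.
  move=> f0 f1; apply: ae_neq0_sgr => //.
  rewrite expect_sgr_stable// -[RHS](expect_cst P2); apply: eq_Rintegral => w _.
  rewrite (_ : cosine _ _ _ = 1) ?acos1 ?mul0r ?mulr0 ?subr0//.
  rewrite /cosine -expr2 sqrtr_sqr ger0_norm; last first.
    by apply/ltW/sum_sqr_gt0.
  under eq_bigr do rewrite -expr2.
  by rewrite divff// gt_eqF// sum_sqr_gt0.
set E := [set w | _].
have mE : measurable E.
  rewrite (_ : E = ~` ((fun w => Num.sg (\sum_i u i * r i w) -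
      Num.sg (\sum_i v i * r i w)) @^-1` [set 0])).
    apply: measurableC; rewrite -[X in measurable X]setTI.
    by apply: measurable_funB => //; apply: measurableT_comp => //; exact: measurable_sgr.
  by apply/seteqP; split => w /=; rewrite /E/=; [move=> /eqP h /subr0_eq|
    move=> h; apply/eqP => e; apply: h; rewrite e subrr].
have bs (f : 'I_D -> R) : bmeas (fun w => Num.sg (\sum_i f i * r i w)).
  exact: bmeas_comp bmeas_sgr (mx f).
have bac : bmeas (fun w => acos (cosine u v (S ^~ w)) / pi).
  by apply: bmeasM; [exact: bmeas_acos_cosine|exact: bmeas_cst].
rewrite -[LHS]fineK ?fin_num_measure// -expect_indic//; congr EFin.
(* Where both sums are nonzero, half of 1 minus the product of signs is the indicator of a sign
   change. *)
transitivity (\int[P1]_w (2^-1 * (1 - Num.sg (\sum_i u i * r i w) * Num.sg (\sum_i v i * r i w)))).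
  apply: ae_eq_expect.
  - exact: measurable_indic.
  - apply: (bmeasZ _ _).1; apply: bmeasB; [exact: bmeas_cst|exact: bmeasM].
  - apply: filterS2 (neq0 _ u0 u1) (neq0 _ v0 v1) => w.
    have wE : (w \in E) = (Num.sg (\sum_i u i * r i w) != Num.sg (\sum_i v i * r i w)).
      by apply/idP/idP; rewrite inE.
    have N11 : (1 != -1 :> R) by rewrite gt_eqF//; lra.
    rewrite indicE wE; case: sgrP => // _ _; case: sgrP => // _ _.
    + by rewrite eqxx/=; field.
    + by rewrite N11/=; field.
    + by rewrite eq_sym N11/=; field.
    + by rewrite eqxx/=; field.
rewrite expectZ; last by apply: bmeasB; [exact: bmeas_cst|exact: bmeasM].
rewrite expectB; [|exact: bmeas_cst|exact: bmeasM].
rewrite expect_cst expect_sgr_stable// expectB; [|exact: bmeas_cst|exact: bmeasZ].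
by rewrite expect_cst expectZ//; field.
Qed.

End sign_correlation.

(** * Expected logarithm of a positive stable variable *)

Section logarithm.
Context {R : realType}.

Let is_derive_pow n (t : R) :
  is_derive t 1 (fun x : R => x ^+ n.+1) (n.+1%:R * t ^+ n).
Proof.
elim: n => [|n ih].
  have h := is_derive_affine (1 : R) 0 t.
  rewrite (_ : (fun x => _) = fun x => 1 * x + 0).
    by apply: (@is_derive_eq _ _ _ _ _ _ _ _ h); rewrite expr0 mulr1.
  by apply/funext => x; rewrite expr1 mul1r addr0.
have h := is_derive_affine (1 : R) 0 t.
have h2 := is_derive_mul h ih.
rewrite (_ : (fun x => _) = fun x => (1 * x + 0) * x ^+ n.+1).
  by apply: (@is_derive_eq _ _ _ _ _ _ _ _ h2); rewrite exprS -[in RHS]natr1; ring.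
by apply/funext => x; rewrite exprS mul1r addr0.
Qed.

(** The remainder of the logarithmic series has the tail of the geometric series as derivative. *)
Let geometric_log_gap n (t : R) : t < 1 ->
  is_derive t 1 (fun x : R => - ln (1 - x) - \sum_(k < n) x ^+ k.+1 / k.+1%:R)
    (t ^+ n / (1 - t)).
Proof.
move=> t1; have t0 : 1 - t != 0 by rewrite gt_eqF// subr_gt0.
elim: n => [|n ih].
  under eq_fun do rewrite big_ord0 subr0.
  have h1 : is_derive t 1 (fun x : R => -1 * x + 1) (-1) by exact: is_derive_affine.
  have h2 : is_derive (-1 * t + 1) 1 (@ln R) (-1 * t + 1)^-1.
    by apply: is_derive1_ln; lra.
  have h3 := is_derive_mul (is_derive_cst (-1 : R) t 1) (is_derive_comp (g := fun x => -1 * x + 1) h2 h1).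
  rewrite (_ : (fun x => _) = (fun y : R => cst (-1) y * ln (-1 * y + 1))); last first.
    by apply/funext => y; rewrite /cst mulN1r; congr (- ln _); ring.
  apply: (@is_derive_eq _ _ _ _ _ _ _ _ h3); rewrite /cst expr0.
  rewrite (_ : -1 * t + 1 = 1 - t); last by ring.
  by field.
have n0 : n.+1%:R != 0 :> R by rewrite pnatr_eq0.
have h4 := is_derive_mul (is_derive_pow n t) (is_derive_cst (- n.+1%:R^-1 : R) t 1).
have h5 := is_deriveD ih h4.
rewrite (_ : (fun x => _) = ((fun x : R => - ln (1 - x) - \sum_(k < n) x ^+ k.+1 / k.+1%:R) +
    (fun y : R => y ^+ n.+1 * cst (- n.+1%:R^-1) y))); last first.
  apply/funext => x; rewrite big_ord_recr/= /cst.
  by rewrite [RHS](_ : _ = - ln (1 - x) - \sum_(k < n) x ^+ k.+1 / k.+1%:R +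
    x ^+ n.+1 * - n.+1%:R^-1)//; ring.
apply: (@is_derive_eq _ _ _ _ _ _ _ _ h5); rewrite /cst exprS.
rewrite mulr0 addr0 mulrN (mulrAC _ _ n.+1%:R^-1) divff// mul1r.
by field.
Qed.

(** Mean value theorem on [0, w]: the remainder is w c^n / (1 - c) for some c below [w]. *)
Lemma ln_series_remainder n (w : R) : 0 <= w < 1 ->
  0 <= - ln (1 - w) - \sum_(k < n) w ^+ k.+1 / k.+1%:R <= w ^+ n.+1 / (1 - w).
Proof.
move=> /andP[]; rewrite le_eqVlt => /predU1P[<- _|w0 w1].
  rewrite subr0 ln1 oppr0 big1 => [|k _]; last by rewrite exprS !mul0r.
  by rewrite subr0 exprS !mul0r lexx.
pose h (x : R) := - ln (1 - x) - \sum_(k < n) x ^+ k.+1 / k.+1%:R.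
have dh (x : R) : x \in `]0, w[ -> is_derive x 1 h (x ^+ n / (1 - x)).
  by rewrite in_itv/= => /andP[_ xw]; apply: geometric_log_gap; exact: lt_trans w1.
have ch : {within `[0, w], continuous h}.
  apply: derivable_within_continuous => x; rewrite in_itv/= => /andP[_ xw].
  have hx : is_derive x 1 h _ := geometric_log_gap n (le_lt_trans xw w1).
  exact: ex_derive.
have [c + e] := MVT w0 dh ch.
rewrite in_itv/= => /andP[c0 cw].
have h0 : h 0 = 0.
  rewrite /h subr0 ln1 oppr0 sub0r big1 ?oppr0// => k _.
  by rewrite exprS !mul0r.
have -> : - ln (1 - w) - \sum_(k < n) w ^+ k.+1 / k.+1%:R = c ^+ n / (1 - c) * w.
  by move: e; rewrite h0 !subr0.
have c1 : 0 < 1 - c by lra.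
have w1' : 0 < 1 - w by lra.
apply/andP; split.
  by rewrite mulr_ge0 ?(ltW w0)// divr_ge0 ?(ltW c1)// exprn_ge0// ltW.
rewrite exprSr [leRHS]mulrAC ler_wpM2r ?(ltW w0)// ler_pM ?exprn_ge0 ?invr_ge0 ?(ltW c1) ?(ltW c0)//.
  by rewrite lerXn2r ?nnegrE ?(ltW c0) ?(ltW w0) ?(ltW cw).
by rewrite lef_pV2 ?posrE//; lra.
Qed.

Lemma one_minus_expRN_bounds (y : R) : 0 < y ->
  y / (1 + y) <= 1 - expR (- y) <= y.
Proof.
move=> y0; apply/andP; split; last by have := expR_ge1Dx (- y); lra.
have h := expR_ge1Dx y; rewrite expRN ler_pdivrMr; last lra.
have e0 : 0 < expR y := expR_gt0 y.
have : (expR y)^-1 <= (1 + y)^-1 by rewrite lef_pV2 ?posrE//; lra.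
have : (1 + y)^-1 * (1 + y) = 1 by rewrite mulVf// gt_eqF//; lra.
nra.
Qed.

(** A bound in terms of |ln x|, which will be integrable, whereas [x] itself need not be. *)
Lemma ln1D_le (x : R) : 0 < x -> ln (1 + x) <= 1 + `|ln x|.
Proof.
move=> x0; have [x1|x1] := leP x 1.
  have h : ln (1 + x) <= x by apply: le_ln1Dx; lra.
  by have := normr_ge0 (ln x); lra.
have h : ln (1 + x) <= ln (2 * x) by rewrite ler_ln ?posrE; lra.
have h2 : ln (2 : R) <= 1.
  by have := @le_ln1Dx R 1; rewrite (_ : 1 + 1 = 2); [apply; lra|lra].
rewrite lnM ?posrE// in h.
have := ler_norm (ln x); lra.
Qed.

(* By the series of [ln (1 - w)], a limit of polynomials in
   [w = expR (- x / m.+1)]: its expectation is determined by the Laplace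
   transform. *)
Definition ln_approx m (x : R) := ln ((1 - expR (- (m.+1%:R^-1 * x))) / m.+1%:R^-1).

(** With y = x / (m + 1), [ln_approx] lies between ln x - ln (1 + y) and ln x. Bounding ln (1 + y)
    by y gives convergence; bounding it by 1 + |ln x| gives domination uniform in [m]. *)
Lemma ln_approx_bounds m (x : R) : 0 < x ->
  ln x - m.+1%:R^-1 * x <= ln_approx m x <= ln x /\
  `|ln_approx m x| <= 1 + 2 * `|ln x|.
Proof.
move=> x0; rewrite /ln_approx; set e : R := m.+1%:R^-1.
have e0 : 0 < e by rewrite invr_gt0.
have e1 : e <= 1 by rewrite invf_le1// ler1n.
have ex0 : 0 < e * x by rewrite mulr_gt0.
have /andP[lo hi] := one_minus_expRN_bounds ex0.
have q0 : 0 < 1 + e * x by lra.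
have p0 : 0 < (1 - expR (- (e * x))) / e.
  by rewrite divr_gt0//; apply: lt_le_trans lo; rewrite divr_gt0.
have up : ln ((1 - expR (- (e * x))) / e) <= ln x.
  by rewrite ler_ln ?posrE// ler_pdivrMr// (mulrC x).
have down : ln x - ln (1 + e * x) <= ln ((1 - expR (- (e * x))) / e).
  have h : x / (1 + e * x) <= (1 - expR (- (e * x))) / e.
    rewrite ler_pdivlMr// (le_trans _ lo)// le_eqVlt; apply/orP; left.
    by apply/eqP; rewrite mulrAC (mulrC x).
  have : ln (x / (1 + e * x)) <= ln ((1 - expR (- (e * x))) / e).
    by rewrite ler_ln ?posrE// divr_gt0.
  by rewrite ln_div ?posrE.
have l1 : ln (1 + e * x) <= e * x by apply: le_ln1Dx; lra.
have l2 : ln (1 + e * x) <= 1 + `|ln x|.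
  apply: le_trans (ln1D_le x0); rewrite ler_ln ?posrE//; nra.
split; first by apply/andP; split; lra.
have a1 := ler_norm (ln x); have a2 : - ln x <= `|ln x| by rewrite -normrN ler_norm.
by rewrite ler_norml; apply/andP; split; lra.
Qed.

Lemma cvg_ln_approx (x : R) : 0 < x -> ln_approx ^~ x @ \oo --> ln x.
Proof.
move=> x0; apply: (squeeze_cvgr (f := fun m => ln x - m.+1%:R^-1 * x) (h := cst (ln x))).
- by apply: nearW => m; have [] := ln_approx_bounds m x0.
- rewrite -[X in _ --> X]subr0; apply: cvgB; first exact: cvg_cst.
  by rewrite -(mul0r x); apply: cvgM; [exact: cvg_harmonic|exact: cvg_cst].
- exact: cvg_cst.
Qed.

(** Up to a factor e, a majorant of the indicator of |ln x| >= k: the first term is at least 1 - 1/e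
    if x >= e^k, the second at least 1/e if x <= e^(-k). Its expectation is read off the Laplace
    transform. *)
Definition ln_bound k (x : R) :=
  (1 - expR (- (expR (- k%:R) * x))) + expR (- (expR k%:R * x)).

Lemma ln_bound_ge0 k x : 0 <= x -> 0 <= ln_bound k x.
Proof.
move=> x0; rewrite addr_ge0 ?expR_ge0// subr_ge0 -expR0 ler_expR oppr_le0.
by rewrite mulr_ge0// expR_ge0.
Qed.

(** With N the integer part of |ln x|, each of the terms k = 0, ..., N is at least 1/e, and |ln x| <
    N + 1. *)
Lemma normr_ln_le (x : R) : 0 < x ->
  exists n, `|ln x| <= expR 1 * \sum_(k < n) ln_bound k x.
Proof.
move=> x0; have e0 : 0 < expR (1 : R) by exact: expR_gt0.
have e2 : 2 <= expR (1 : R) by have := expR_ge1Dx (1 : R); lra.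
have /andP[n1 n2] := truncn_itv (normr_ge0 (ln x)).
exists (Num.truncn `|ln x|).+1; set n := Num.truncn _ in n1 n2 *.
apply: (le_trans (ltW n2)).
rewrite mulrC -ler_pdivrMr//.
rewrite (_ : _ / _ = \sum_(k < n.+1) (expR 1)^-1); last first.
  by rewrite sumr_const card_ord mulr_natl.
apply: ler_sum => k _.
have kn : (k%:R : R) <= `|ln x|.
  by apply: le_trans n1; rewrite ler_nat -ltnS.
have inv_e : expR (-1 : R) = (expR 1)^-1 by rewrite expRN.
rewrite /ln_bound; have [lx|lx] := leP 0 (ln x).
  rewrite ger0_norm// in kn.
  have h : 1 <= expR (- k%:R) * x.
    have -> : expR (- k%:R) * x = expR (- k%:R + ln x) by rewrite expRD lnK.
    by rewrite -[leLHS]expR0 ler_expR; lra.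
  have : expR (- (expR (- k%:R) * x)) <= (expR 1)^-1 by rewrite -inv_e ler_expR; lra.
  have : (expR 1)^-1 <= (2^-1 : R) by rewrite lef_pV2 ?posrE.
  have := expR_ge0 (- (expR k%:R * x)).
  lra.
rewrite ltr0_norm// in kn.
have h : expR k%:R * x <= 1.
  have -> : expR k%:R * x = expR (k%:R + ln x) by rewrite expRD lnK.
  by rewrite -[leRHS]expR0 ler_expR; lra.
have : (expR 1)^-1 <= expR (- (expR k%:R * x)) by rewrite -inv_e ler_expR; lra.
have : expR (- (expR (- k%:R) * x)) <= 1.
  by rewrite -[leRHS]expR0 ler_expR oppr_le0 mulr_ge0 ?expR_ge0// ltW.
lra.
Qed.

End logarithm.

(** * Integrability of the logarithm and uniqueness of its expectation *)

Section expected_logarithm.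
Context {R : realType} {d} {T : measurableType d} (P : probability T R) (beta : R).
Hypothesis beta0 : 0 < beta.

Let integrable_affine_norm (a b : R) (f : T -> R) : P.-integrable setT (EFin \o f) ->
  P.-integrable setT (EFin \o (fun w => a + b * `|f w|)).
Proof.
move=> intf.
have h1 : P.-integrable setT (EFin \o (fun=> a) : T -> \bar R).
  exact: (bmeas_integrable P (bmeas_cst a)).
have h2 : P.-integrable setT (EFin \o (fun w => b * `|f w|)).
  have := integrableZl measurableT b (integrable_norm intf).
  by apply: eq_integrable => // w _; rewrite /= EFinM.
have := integrableD measurableT h1 h2.
by apply: eq_integrable => // w _; rewrite /= EFinD.
Qed.

Definition stable_laplace (X : T -> R) := [/\ measurable_fun setT X,
  (forall w, 0 < X w) &
  forall s, 0 <= s -> \int[P]_w expR (- (s * X w)) = expR (- (s `^ beta))].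

Let bmeas_expRN (X : T -> R) s : measurable_fun setT X -> (forall w, 0 < X w) -> 0 <= s ->
  bmeas (fun w => expR (- (s * X w))).
Proof.
move=> mX X0 s0; split.
  by apply: measurableT_comp => //; apply: measurableT_comp => //; exact: measurable_funM.
exists 1 => w; rewrite ger0_norm ?expR_ge0// -expR0 ler_expR oppr_le0.
by rewrite mulr_ge0// ltW.
Qed.

(** Both 1 - exp(- e^(- k beta)) and exp(- e^(k beta)) are at most e^(- k beta), so the expectations
    of [ln_bound k] are summable. *)
Lemma integrable_ln_stable X : stable_laplace X -> P.-integrable setT (EFin \o (fun w => ln (X w))).
Proof.
move=> [mX X0 LX].
have b1 k : bmeas (fun w => 1 - expR (- (expR (- k%:R) * X w))).
  by apply: bmeasB; [exact: bmeas_cst|apply: bmeas_expRN => //; exact: expR_ge0].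
have b2 k : bmeas (fun w => expR (- (expR k%:R * X w))).
  by apply: bmeas_expRN => //; exact: expR_ge0.
have bL k : bmeas (fun w => ln_bound k (X w)) by exact: bmeasD.
pose q : R := expR (- beta).
have q1 : `|q| < 1 by rewrite ger0_norm ?expR_ge0// expR_lt1 oppr_lt0.
have Ek k : \int[P]_w ln_bound k (X w) <= 2 * q ^+ k.
  rewrite expectD// expectB; [|exact: bmeas_cst|by apply: bmeas_expRN => //; exact: expR_ge0].
  rewrite expect_cst !LX ?expR_ge0// -!expRM.
  have -> : q ^+ k = expR (- k%:R * beta) by rewrite /q -expRM_natl; congr expR; ring.
  have h1 := expR_ge1Dx (- expR (- k%:R * beta)).
  have h2 := expR_ge1Dx (expR (k%:R * beta)).
  have h3 : expR (- expR (k%:R * beta)) <= expR (- k%:R * beta).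
    by rewrite mulNr expRN (expRN (k%:R * beta)) lef_pV2 ?posrE ?expR_gt0//; lra.
  lra.
have intS : (\int[P]_w (\sum_(0 <= k <oo) (ln_bound k (X w))%:E) < +oo)%E.
  rewrite integral_nneseries//; last 2 first.
  - by move=> k; apply/measurable_EFinP; exact: (bL k).1.
  - by move=> k w _; rewrite lee_fin ln_bound_ge0// ltW.
  apply: (@le_lt_trans _ _ (\sum_(0 <= k <oo) (2 * q ^+ k)%:E)%E).
    apply: lee_nneseries => [k _ _|k _].
      by apply: integral_ge0 => w _; rewrite lee_fin ln_bound_ge0// ltW.
    by rewrite EFin_Rintegral// lee_fin.
  apply: (@le_lt_trans _ _ (2 * (1 - q)^-1)%:E); last exact: ltry.
  apply: lime_le.
    by apply: is_cvg_nneseries => k _ _; rewrite lee_fin mulr_ge0// exprn_ge0// expR_ge0.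
  apply: nearW => n; rewrite sumEFin lee_fin.
  by apply: geometric_le_lim => //; exact: expR_gt0.
apply/integrableP; split; first by apply/measurable_EFinP; exact: measurableT_comp.
have mser : measurable_fun setT (fun w => \sum_(0 <= k <oo) (ln_bound k (X w))%:E)%E.
  apply: ge0_emeasurable_sum.
    by move=> k w _ _; rewrite lee_fin ln_bound_ge0// ltW.
  by move=> k _; apply/measurable_EFinP; exact: (bL k).1.
apply: (@le_lt_trans _ _ (\int[P]_w ((expR 1)%:E * \sum_(0 <= k <oo) (ln_bound k (X w))%:E))%E).
  apply: ge0_le_integral => //.
  - by apply: measurableT_comp => //; apply/measurable_EFinP; exact: measurableT_comp.
  - exact: measurable_funeM.
  - move=> w _; have [n hn] := normr_ln_le (X0 w).
    rewrite /= (@le_trans _ _ (expR 1 * \sum_(k < n) ln_bound k (X w))%:E)//.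
    rewrite EFinM lee_wpmul2l ?lee_fin ?expR_ge0//.
    rewrite -sumEFin -(big_mkord xpredT (fun k => (ln_bound k (X w))%:E)).
    apply: nneseries_lim_ge => k _ _; by rewrite lee_fin ln_bound_ge0// ltW.
rewrite ge0_integralZl//.
- by rewrite lte_mul_pinfty// lee_fin expR_ge0.
- by move=> w _; apply: nneseries_ge0 => k _ _; rewrite lee_fin ln_bound_ge0// ltW.
Qed.

Let measurable_ln_approx m (X : T -> R) : measurable_fun setT X ->
  measurable_fun setT (fun w => ln_approx m (X w)).
Proof.
move=> mX; rewrite /ln_approx; apply: measurableT_comp => //; apply: measurable_funM => //.
apply: measurable_funB => //; apply: measurableT_comp => //.
by apply: measurableT_comp => //; exact: measurable_funM.
Qed.

Lemma expect_ln_stable X Y : stable_laplace X -> stable_laplace Y ->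
  \int[P]_w ln (X w) = \int[P]_w ln (Y w).
Proof.
(* The sequence involves no [Z], only the common Laplace transform, so its limit is the same for [X]
   and [Y]. *)
have main Z m : stable_laplace Z ->
    (fun n => \sum_(k < n) expR (- ((k.+1%:R * m.+1%:R^-1) `^ beta)) / k.+1%:R) @ \oo -->
    - (\int[P]_w ln_approx m (Z w)) - ln m.+1%:R^-1.
  move=> sZ; have [mZ Z0 LZ] := sZ.
  set e : R := m.+1%:R^-1; have e0 : 0 < e by rewrite invr_gt0.
  pose f n w := \sum_(k < n) expR (- (k.+1%:R * e * Z w)) / k.+1%:R.
  have bt k : bmeas (fun w => expR (- (k.+1%:R * e * Z w)) / k.+1%:R).
    apply: bmeasM; last exact: bmeas_cst.
    by apply: bmeas_expRN => //; rewrite mulr_ge0// ltW.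
  have Ef n : bmeas (f n) /\
      \int[P]_w f n w = \sum_(k < n) expR (- ((k.+1%:R * e) `^ beta)) / k.+1%:R.
    elim: n => [|n [bn En]].
      rewrite /f big_ord0; under eq_fun do rewrite big_ord0.
      by split; [exact: bmeas_cst|exact: expect_cst].
    rewrite /f big_ord_recr/= -En; under eq_fun do rewrite big_ord_recr/=.
    split; first by apply: bmeasD => //; exact: bt.
    rewrite expectD; [|exact: bn|exact: bt].
    congr (_ + _); under eq_Rintegral do rewrite mulrC.
    rewrite expectZ; last by apply: bmeas_expRN => //; rewrite mulr_ge0// ltW.
    by rewrite LZ ?mulr_ge0 ?(ltW e0)// mulrC.
  under eq_fun => n do rewrite -(Ef n).2.
  have lnE w : - ln (1 - expR (- (e * Z w))) = - ln_approx m (Z w) - ln e.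
    have w0 : 0 < 1 - expR (- (e * Z w)).
      by rewrite subr_gt0 expR_lt1 oppr_lt0 mulr_gt0.
    by rewrite /ln_approx -/e ln_div ?posrE//; ring.
  have ilnZ := integrable_ln_stable sZ.
  have ig : P.-integrable setT (EFin \o (fun w => (1 + `|ln e|) + 2 * `|ln (Z w)|)).
    exact: integrable_affine_norm.
  have ia : P.-integrable setT (EFin \o (fun w => ln_approx m (Z w))).
    apply: (@le_integrable _ _ _ P setT measurableT _ (EFin \o (fun w => 1 + 2 * `|ln (Z w)|))).
    - apply/measurable_EFinP; exact: measurable_ln_approx.
    - move=> w _; rewrite /= lee_fin [leRHS]ger0_norm; last by rewrite addr_ge0// mulr_ge0.
      by have [] := ln_approx_bounds m (Z0 w).
    - exact: integrable_affine_norm.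
  have -> : - (\int[P]_w ln_approx m (Z w)) - ln e = \int[P]_w (- ln (1 - expR (- (e * Z w)))).
    have ic : P.-integrable setT (EFin \o (fun=> - ln e) : T -> \bar R).
      exact: (bmeas_integrable P (bmeas_cst (- ln e))).
    have iN : P.-integrable setT (EFin \o (fun w => -1 * ln_approx m (Z w))).
      have := integrableZl measurableT (-1) ia.
      by apply: eq_integrable => // w _; rewrite /= EFinM.
    transitivity (\int[P]_w (-1 * ln_approx m (Z w) + - ln e)).
      by rewrite RintegralD// RintegralZl// expect_cst mulN1r.
    by apply: eq_Rintegral => w _; rewrite lnE mulN1r.
  have hw w : 0 <= expR (- (e * Z w)) < 1.
    by rewrite expR_ge0/= expR_lt1 oppr_lt0 mulr_gt0.
  have fE n w : f n w = \sum_(k < n) expR (- (e * Z w)) ^+ k.+1 / k.+1%:R.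
    by apply: eq_bigr => k _; rewrite -expRM_natl; congr (expR _ / _); ring.
  apply: (dominated_cvg_expect _ ig).
  - by move=> n; exact: (Ef n).1.1.
  (* All terms are nonnegative, so the partial sums lie between 0 and the full series, itself
     bounded in terms of |ln Z|. *)
  - move=> n w; have /andP[+ _] := ln_series_remainder n (hw w).
    rewrite -fE lnE => h.
    have f0 : 0 <= f n w by apply: sumr_ge0 => k _; rewrite divr_ge0 ?expR_ge0.
    rewrite ger0_norm//.
    have [_ h2] := ln_approx_bounds m (Z0 w).
    have h3 : - ln_approx m (Z w) <= `|ln_approx m (Z w)| by rewrite -normrN ler_norm.
    have h4 : - ln e <= `|ln e| by rewrite -normrN ler_norm.
    lra.
  - move=> w; set y := expR (- (e * Z w)); have /andP[y0 y1] := hw w.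
    apply: (squeeze_cvgr (f := fun n => - ln (1 - y) - y ^+ n.+1 / (1 - y)) (h := cst (- ln (1 - y)))).
    + apply: nearW => n; have /andP[h1 h2] := ln_series_remainder n (hw w).
      by rewrite fE; apply/andP; split; rewrite /=; lra.
    + rewrite -[X in _ --> X]subr0; apply: cvgB; first exact: cvg_cst.
      rewrite -(mul0r (1 - y)^-1); apply: cvgM; last exact: cvg_cst.
      have : (fun n => y ^+ n) @ \oo --> (0 : R) by apply: cvg_expr; rewrite ger0_norm.
      by rewrite -(cvg_shiftS).
    + exact: cvg_cst.
move=> sX sY.
have approx_eq m : \int[P]_w ln_approx m (X w) = \int[P]_w ln_approx m (Y w).
  have e := cvg_unique (@Rhausdorff R) (main X m sX) (main Y m sY).
  by apply: oppr_inj; apply: addIr; exact: e _.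
have lim Z : stable_laplace Z ->
    (fun m => \int[P]_w ln_approx m (Z w)) @ \oo --> \int[P]_w ln (Z w).
  move=> sZ; have [mZ Z0 _] := sZ; have ilnZ := integrable_ln_stable sZ.
  have ig : P.-integrable setT (EFin \o (fun w => 1 + 2 * `|ln (Z w)|)).
    exact: integrable_affine_norm.
  apply: (dominated_cvg_expect _ ig).
  - by move=> m; exact: measurable_ln_approx.
  - by move=> m w; have [] := ln_approx_bounds m (Z0 w).
  - by move=> w; exact: cvg_ln_approx.
have limY := lim Y sY.
rewrite (_ : (fun m => _) = fun m => \int[P]_w ln_approx m (X w)) in limY.
  exact: (cvg_unique _ (lim X sX) limY).
by apply/funext => m; rewrite approx_eq.
Qed.

End expected_logarithm.

(** * The upper bound *)

Section acos_tangent.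
Context {R : realType}.

(** Concavity of the cosine on [0, pi / 2], from monotonicity of the sine and the mean value
    theorem. *)
Lemma cos_le_tangent (phi theta : R) : 0 <= phi <= pi / 2 -> 0 <= theta <= pi / 2 ->
  cos phi <= cos theta + sin theta * (theta - phi).
Proof.
move=> /andP[p0 p1] /andP[t0 t1].
have dc (x : R) : is_derive x 1 (@cos R) (- sin x) by exact: is_derive_cos.
have cc a b : {within `[a, b], continuous (@cos R)}.
  by apply: continuous_subspaceT; exact: continuous_cos.
have sin_le (a b : R) : 0 <= a -> a <= b -> b <= pi / 2 -> sin a <= sin b.
  move=> a0 ab b1; move: ab; rewrite le_eqVlt => /predU1P[->//|ab].
  by apply/ltW; rewrite ltr_sin// in_itv/=; apply/andP; split; lra.
have [pt|tp|->] := ltgtP phi theta; last by rewrite subrr mulr0 addr0.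
- have [x + e] := MVT pt (fun x _ => dc x) (cc phi theta).
  rewrite in_itv/= => /andP[x1 x2].
  have h := sin_le x theta (ltW (le_lt_trans p0 x1)) (ltW x2) t1.
  nra.
- have [x + e] := MVT tp (fun x _ => dc x) (cc theta phi).
  rewrite in_itv/= => /andP[x1 x2].
  have h := sin_le theta x t0 (ltW x1) (le_trans (ltW x2) p1).
  nra.
Qed.

Lemma acos_le_pihalf (x : R) : 0 <= x <= 1 -> acos x <= pi / 2.
Proof.
move=> /andP[x0 x1]; have x11 : -1 <= x <= 1 by apply/andP; split; lra.
rewrite leNgt; apply/negP => h.
have : cos (acos x) < cos (pi / 2).
  rewrite ltr_cos// in_itv/=; last by rewrite acos_ge0// acos_lepi.
  by have := pi_gt0 R => h'; apply/andP; split; lra.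
by rewrite acosK// cos_pihalf; lra.
Qed.

(* Tangent line at [theta] of the concave function [w |-> acos (expR w)]. *)
Lemma acos_le_log_tangent (theta z : R) : 0 < theta < pi / 2 -> 0 < z <= 1 ->
  acos z <= theta - cos theta / sin theta * (ln z - ln (cos theta)).
Proof.
move=> /andP[t0 t1] /andP[z0 z1].
have zi : -1 <= z <= 1 by apply/andP; split; lra.
have a0 := acos_ge0 zi; have ca : cos (acos z) = z by rewrite acosK.
have ct : 0 < cos theta by apply: cos_gt0_pihalf; apply/andP; split; lra.
have st : 0 < sin theta by apply: sin_gt0_pihalf; apply/andP; split.
have a1 : acos z <= pi / 2 by rewrite acos_le_pihalf// ltW.
have key : z <= cos theta + sin theta * (theta - acos z).
  by rewrite -{1}ca; apply: cos_le_tangent; apply/andP; split => //; lra.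
have lz : ln z - ln (cos theta) <= z / cos theta - 1.
  rewrite -ln_div ?posrE//.
  have : 0 < z / cos theta by rewrite divr_gt0.
  move=> h; have := @le_ln1Dx R (z / cos theta - 1).
  by rewrite (_ : 1 + (z / cos theta - 1) = z / cos theta); [apply; lra|ring].
have h1 : cos theta / sin theta * (ln z - ln (cos theta)) <=
    cos theta / sin theta * (z / cos theta - 1).
  by rewrite ler_wpM2l// divr_ge0// ltW.
have h2 : cos theta / sin theta * (z / cos theta - 1) = (z - cos theta) / sin theta.
  by field; rewrite !gt_eqF.
have h3 : (z - cos theta) / sin theta <= theta - acos z.
  by rewrite ler_pdivrMr// mulrC; lra.
lra.
Qed.

End acos_tangent.

(** * Jensen's inequality for the arccosine *)

Section acos_inequality.
Context {R : realType} {alpha : R} {D : nat}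
  {d2} {Omega2 : measurableType d2} (P2 : probability Omega2 R)
  (S : 'I_D -> Omega2 -> R) (u v : 'I_D -> R).
Hypothesis alpha0 : 0 < alpha.
Hypothesis mS : forall i, measurable_fun setT (S i).
Hypothesis S0 : forall i w, 0 < S i w.
Hypothesis laplace_S : forall s : 'I_D -> R, (forall i, 0 <= s i) ->
  \int[P2]_w expR (- \sum_i s i * S i w) = expR (- \sum_i s i `^ (alpha / 2)).
Hypothesis u0 : forall i, 0 <= u i.
Hypothesis v0 : forall i, 0 <= v i.
Hypothesis u1 : exists i, 0 < u i.
Hypothesis v1 : exists i, 0 < v i.

Let beta := alpha / 2.
Let beta0 : 0 < beta. Proof. by rewrite divr_gt0. Qed.

Let sum_gt0 (a b : 'I_D -> R) : (forall i, 0 <= a i) -> (forall i, 0 < b i) ->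
  (exists i, 0 < a i) -> 0 < \sum_i a i * b i.
Proof.
move=> a0 b0 [j aj]; rewrite (bigD1 j)//= ltr_pwDl ?mulr_gt0//.
by apply: sumr_ge0 => i _; rewrite mulr_ge0// ltW.
Qed.

Let scale (a : 'I_D -> R) := \sum_i a i `^ beta.

Let scale_gt0 (a : 'I_D -> R) : (exists i, 0 < a i) -> 0 < scale a.
Proof.
move=> [j aj]; rewrite /scale (bigD1 j)//= ltr_pwDl ?powR_gt0//.
by apply: sumr_ge0 => i _; exact: powR_ge0.
Qed.

(** Strict stability: the coefficients act only through [scale a], and dividing by its power 1 /
    beta restores the Laplace transform of a single [S i]. *)
Let stable_combination (a : 'I_D -> R) : (forall i, 0 <= a i) -> (exists i, 0 < a i) ->
  stable_laplace P2 beta (fun w => (\sum_i a i * S i w) / scale a `^ beta^-1).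
Proof.
move=> a0 a1; have c0 := scale_gt0 a1; have c1 : 0 < scale a `^ beta^-1 by rewrite powR_gt0.
split.
- apply: measurable_funM => //; apply: measurable_sum => i; exact: measurable_funM.
- by move=> w; rewrite divr_gt0// sum_gt0.
move=> s s0.
transitivity (\int[P2]_w expR (- \sum_i (s * a i / scale a `^ beta^-1) * S i w)).
  apply: eq_Rintegral => w _; congr (expR (- _)).
  rewrite mulrA mulr_sumr mulr_suml; apply: eq_bigr => i _.
  by rewrite mulrA mulrAC.
rewrite laplace_S; last by move=> i; rewrite divr_ge0 ?mulr_ge0// ltW.
congr (expR (- _)).
transitivity (\sum_i s `^ beta * a i `^ beta / scale a).
  apply: eq_bigr => i _; rewrite powRM ?mulr_ge0 ?invr_ge0 ?(ltW c1)// powRM//; congr (_ * _).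
  rewrite -powR_inv1 ?powR_ge0// -!powRrM mulN1r mulrN mulVf ?gt_eqF//.
  by rewrite powR_inv1// ltW.
rewrite -mulr_suml -mulr_sumr -/(scale a) mulfK// gt_eqF//.
Qed.

(** The normalised combination with coefficients [u] is a fixed reference variable; its expected
    logarithm is the unknown that later cancels. *)
Let expect_ln_combination (a : 'I_D -> R) (a0 : forall i, 0 <= a i) (a1 : exists i, 0 < a i) :
  P2.-integrable setT (EFin \o (fun w => ln (\sum_i a i * S i w))) /\
  \int[P2]_w ln (\sum_i a i * S i w) =
  \int[P2]_w ln ((\sum_i u i * S i w) / scale u `^ beta^-1) + beta^-1 * ln (scale a).
Proof.
have sa := stable_combination a0 a1.
have c0 := scale_gt0 a1; have c1 : 0 < scale a `^ beta^-1 by rewrite powR_gt0.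
have e w : ln (\sum_i a i * S i w) =
    ln ((\sum_i a i * S i w) / scale a `^ beta^-1) + beta^-1 * ln (scale a).
  have p1 : 0 < \sum_i a i * S i w by exact: sum_gt0.
  have -> : ln ((\sum_i a i * S i w) / scale a `^ beta^-1) =
      ln (\sum_i a i * S i w) - ln (scale a `^ beta^-1).
    by apply: ln_div; rewrite posrE.
  by rewrite ln_powR subrK.
have i1 := integrable_ln_stable beta0 sa.
have i2 : P2.-integrable setT (EFin \o (fun=> beta^-1 * ln (scale a)) : Omega2 -> \bar R).
  exact: (bmeas_integrable P2 (bmeas_cst _)).
have i3 := integrableD measurableT i1 i2.
split.
  by apply: eq_integrable i3 => // w _; rewrite /= e EFinD.
have e_ln := expect_ln_stable beta0 sa (stable_combination u0 u1).
have k_cst := expect_cst P2 (beta^-1 * ln (scale a)).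
apply: etrans (congr2 +%R e_ln k_cst); rewrite -(RintegralD measurableT i1 i2).
by apply: eq_Rintegral => w _; exact: e.
Qed.

Let rho := ((\sum_(i < D) u i `^ (alpha / 2) * v i `^ (alpha / 2)) /
  Num.sqrt ((\sum_(i < D) u i `^ alpha) * (\sum_(i < D) v i `^ alpha))) `^ (2 / alpha).

Let uv i := u i * v i.
Let scale_uv : \sum_(i < D) u i `^ (alpha / 2) * v i `^ (alpha / 2) = scale uv.
Proof. by apply: eq_bigr => i _; rewrite powRM. Qed.

Let scale_sqr (a : 'I_D -> R) : (forall i, 0 <= a i) ->
  \sum_(i < D) a i `^ alpha = scale (fun i => a i ^+ 2).
Proof.
move=> a0; apply: eq_bigr => i _.
by rewrite -powR_mulrn// -powRrM; congr powR; rewrite /beta; field.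
Qed.

Let sqr1 (a : 'I_D -> R) : (exists i, 0 < a i) -> exists i, 0 < a i ^+ 2.
Proof. by move=> [i ai]; exists i; rewrite exprn_gt0. Qed.

(** The reference expectation cancels between the three combinations. What remains are the
    logarithms of their scales, which assemble into ln rho because 1 / beta = 2 / alpha. *)
Lemma expect_ln_cosine : (exists i, 0 < uv i) ->
  P2.-integrable setT (EFin \o (fun w => ln (cosine u v (S ^~ w)))) /\
  \int[P2]_w ln (cosine u v (S ^~ w)) = ln rho.
Proof.
move=> uv1.
have uv0 i : 0 <= uv i by rewrite mulr_ge0.
have uu0 (a : 'I_D -> R) i : 0 <= a i ^+ 2 by exact: sqr_ge0.
have [iC EC] := expect_ln_combination uv0 uv1.
have [iA EA] := expect_ln_combination (uu0 u) (sqr1 u1).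
have [iB EB] := expect_ln_combination (uu0 v) (sqr1 v1).
have lnsqrt (x : R) : 0 < x -> ln (Num.sqrt x) = 2^-1 * ln x.
  by move=> x0; rewrite -powR12_sqrt ?ltW// ln_powR.
have e w : ln (cosine u v (S ^~ w)) = ln (\sum_i uv i * S i w) +
    - 2^-1 * (ln (\sum_i u i ^+ 2 * S i w) + ln (\sum_i v i ^+ 2 * S i w)).
  have a0 : 0 < \sum_i u i ^+ 2 * S i w by exact: sum_sqr_gt0.
  have b0 : 0 < \sum_i v i ^+ 2 * S i w by exact: sum_sqr_gt0.
  rewrite /cosine ln_div ?posrE ?sqrtr_gt0 ?mulr_gt0//; last exact: (sum_gt0 uv0).
  by rewrite lnsqrt ?mulr_gt0// lnM ?posrE// mulNr.
have iAB := integrableD measurableT iA iB.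
have iAB' : P2.-integrable setT (EFin \o (fun w =>
    ln (\sum_i u i ^+ 2 * S i w) + ln (\sum_i v i ^+ 2 * S i w))).
  by apply: eq_integrable iAB => // w _; rewrite /= EFinD.
have iABh : P2.-integrable setT (EFin \o (fun w => - 2^-1 *
    (ln (\sum_i u i ^+ 2 * S i w) + ln (\sum_i v i ^+ 2 * S i w)))).
  have := integrableZl measurableT (- 2^-1) iAB'.
  by apply: eq_integrable => // w _; rewrite /= EFinM.
split.
  have := integrableD measurableT iC iABh.
  by apply: eq_integrable => // w _; rewrite /= e EFinD.
have -> : \int[P2]_w ln (cosine u v (S ^~ w)) =
    \int[P2]_w ln (\sum_i uv i * S i w) +
    - 2^-1 * (\int[P2]_w ln (\sum_i u i ^+ 2 * S i w) +
              \int[P2]_w ln (\sum_i v i ^+ 2 * S i w)).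
  rewrite -(RintegralD measurableT iA iB) -(RintegralZl _ measurableT iAB').
  rewrite -(RintegralD measurableT iC iABh).
  by apply: eq_Rintegral => w _; exact: e.
rewrite EC EA EB.
have kC := scale_gt0 uv1; have kA := scale_gt0 (sqr1 u1); have kB := scale_gt0 (sqr1 v1).
rewrite /rho scale_uv (scale_sqr u0) (scale_sqr v0) ln_powR ln_div ?posrE ?sqrtr_gt0 ?mulr_gt0//.
rewrite lnsqrt ?mulr_gt0// lnM ?posrE// (_ : 2 / alpha = beta^-1); last by rewrite invf_div.
by field; rewrite gt_eqF.
Qed.

Lemma expect_acos_cosine_le :
  \int[P2]_w acos (cosine u v (S ^~ w)) <= acos rho.
Proof.
have c01 w : 0 <= cosine u v (S ^~ w) <= 1 by rewrite cosine_ge0// cosine_le1.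
have bac : bmeas (fun w => acos (cosine u v (S ^~ w))) by exact: bmeas_acos_cosine.
have Ele : \int[P2]_w acos (cosine u v (S ^~ w)) <= pi / 2.
  rewrite -[leRHS](expect_cst P2); apply: le_expect => //; first exact: bmeas_cst.
  by move=> w; exact: acos_le_pihalf.
have [uv1|nuv] := pselect (exists i, 0 < uv i); last first.
  have uv0 i : uv i = 0.
    apply/eqP; rewrite eq_le (mulr_ge0 (u0 i) (v0 i)) andbT leNgt; apply/negP => h.
    by apply: nuv; exists i.
  suff -> : rho = 0 by rewrite acos0.
  rewrite /rho scale_uv /scale big1 ?mul0r ?powR0//.
    by rewrite gt_eqF// divr_gt0.
  by move=> i _; rewrite uv0 powR0// gt_eqF.
have [iln Eln] := expect_ln_cosine uv1.
have c0 w : 0 < cosine u v (S ^~ w).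
  rewrite divr_gt0 ?sqrtr_gt0 ?mulr_gt0 ?sum_sqr_gt0//.
  by apply: sum_gt0 => // i; rewrite mulr_ge0.
have rho0 : 0 < rho.
  rewrite powR_gt0// scale_uv (scale_sqr u0) (scale_sqr v0) divr_gt0 ?scale_gt0//.
  by rewrite sqrtr_gt0 mulr_gt0// scale_gt0//; exact: sqr1.
(* Cauchy-Schwarz comes for free: ln rho is the expectation of ln c, which is never positive. *)
have rho1 : rho <= 1.
  rewrite -ler_ln ?posrE// ln1 -Eln -[leRHS](expect_cst P2).
  apply: le_Rintegral => //; first exact: (bmeas_integrable P2 (bmeas_cst _)).
  by move=> w _; apply: ln_le0; have /andP[] := c01 w.
have rho11 : -1 <= rho <= 1 by apply/andP; split; lra.
rewrite leNgt; apply/negP => lt_E.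
set E := \int[P2]_w _ in Ele lt_E.
(* The assumed strict inequality puts the midpoint inside (0, pi / 2) even if [rho] is 1. There cos
   theta < rho, so integrating the tangent bound gives E <= theta < E. *)
pose theta := (acos rho + E) / 2.
have a0 := acos_ge0 rho11.
have t0 : 0 < theta < pi / 2 by rewrite /theta; apply/andP; split; lra.
have /andP[t0' t1'] := t0.
have ct : cos theta < rho.
  rewrite -[ltRHS](acosK (x := rho)) ?in_itv//= ltr_cos ?in_itv//=.
  - by rewrite /theta; lra.
  - by apply/andP; split; lra.
  - by apply/andP; split; lra.
have ct0 : 0 < cos theta by apply: cos_gt0_pihalf; apply/andP; split; lra.
have st0 : 0 < sin theta by exact: sin_gt0_pihalf.
pose k := cos theta / sin theta.
have k0 : 0 <= k by rewrite divr_ge0// ltW.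
have ik : P2.-integrable setT (EFin \o (fun w => - k * ln (cosine u v (S ^~ w)))).
  have := integrableZl measurableT (- k) iln.
  by apply: eq_integrable => // w _; rewrite /= EFinM.
have ic : P2.-integrable setT (EFin \o (fun=> theta + k * ln (cos theta)) : Omega2 -> \bar R).
  exact: (bmeas_integrable P2 (bmeas_cst _)).
have ikc : P2.-integrable setT (EFin \o (fun w =>
    (theta + k * ln (cos theta)) + - k * ln (cosine u v (S ^~ w)))).
  have := integrableD measurableT ic ik.
  by apply: eq_integrable => // w _; rewrite /= EFinD.
have : E <= \int[P2]_w ((theta + k * ln (cos theta)) + - k * ln (cosine u v (S ^~ w))).
  apply: le_Rintegral => //; first exact: bmeas_integrable.
  move=> w _; have /andP[_ cw1] := c01 w.
  have := @acos_le_log_tangent _ theta (cosine u v (S ^~ w)) t0; rewrite c0 cw1 => /(_ isT).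
  by rewrite -/k; lra.
rewrite (RintegralD measurableT ic ik) (expect_cst P2) (RintegralZl _ measurableT iln) Eln.
have h : ln (cos theta) < ln rho by rewrite ltr_ln.
have : 0 <= k * (ln rho - ln (cos theta)) by rewrite mulr_ge0//; lra.
rewrite /theta; lra.
Qed.

End acos_inequality.

Theorem theorem1 (R : realType) (alpha : R) (D : nat)
  (d1 : measure_display) (Omega1 : measurableType d1) (P1 : probability Omega1 R)
  (d2 : measure_display) (Omega2 : measurableType d2) (P2 : probability Omega2 R)
  (u v : 'I_D -> R) (r T : 'I_D -> {RV _ >-> R}) :
  0 < alpha -> alpha < 2 -> (1 <= D)%N ->
  (forall i, 0 <= u i) -> (forall i, 0 <= v i) ->
  (exists i, 0 < u i) -> (exists i, 0 < v i) ->
  (* r_1..r_D i.i.d. symmetric alpha-stable: E e^{i t r} = e^{-|t|^alpha} *)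
  @mutually_independent _ _ _ P1 D r ->
  (forall i (t : R),
      (\int[P1]_w (cos (t * r i w))%:E = (expR (- (`|t| `^ alpha)))%:E)%E /\
      (\int[P1]_w (sin (t * r i w))%:E = 0)%E) ->
  (* T_1..T_D i.i.d. positive with E e^{-sT} = e^{-s^{alpha/2}} *)
  @mutually_independent _ _ _ P2 D T ->
  (forall i, {ae P2, forall w, 0 < T i w}) ->
  (forall i (s : R), 0 <= s ->
      (\int[P2]_w (expR (- (s * T i w)))%:E = (expR (- (s `^ (alpha / 2))))%:E)%E) ->
  let x := fun w => \sum_(i < D) u i * r i w in
  let y := fun w => \sum_(i < D) v i * r i w in
  let rho := ((\sum_(i < D) u i `^ (alpha / 2) * v i `^ (alpha / 2)) /
               Num.sqrt ((\sum_(i < D) u i `^ alpha) * (\sum_(i < D) v i `^ alpha)))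
               `^ (2 / alpha) in
  P1 [set w | Num.sg (x w) != Num.sg (y w)] =
    (\int[P2]_w (acos ((\sum_(i < D) u i * v i * T i w) /
        Num.sqrt ((\sum_(i < D) u i ^+ 2 * T i w) * (\sum_(i < D) v i ^+ 2 * T i w))) / pi)%:E)%E
  /\ (P1 [set w | Num.sg (x w) != Num.sg (y w)] <= (acos rho / pi)%:E)%E.
Proof.
move=> alpha0 _ _ u0 v0 u1 v1 indep_r cf_r indep_T T0 laplace_T x y rho.
have mr i : measurable_fun setT (r i) by [].
have mT i : measurable_fun setT (T i) by [].
have cos_ri i (t : R) : \int[P1]_w cos (t * r i w) = expR (- (`|t| `^ alpha)).
  by rewrite /Rintegral (cf_r i t).1.
have sin_ri i (t : R) : \int[P1]_w sin (t * r i w) = 0.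
  by rewrite /Rintegral (cf_r i t).2.
have cos_r (a : 'I_D -> R) :
    \int[P1]_w cos (\sum_i a i * r i w) = expR (- \sum_i `|a i| `^ alpha).
  rewrite (expect_cos_sin_indep indep_r (fun i => sin_ri i (a i))).1.
  by rewrite -sumrN expR_sum; apply: eq_bigr => i _.
have sin_r (a : 'I_D -> R) : \int[P1]_w sin (\sum_i a i * r i w) = 0.
  by rewrite (expect_cos_sin_indep indep_r (fun i => sin_ri i (a i))).2.
(* Each [T i] is positive only almost surely; [S i] is an everywhere positive version, with 1 as an
   arbitrary filler on a null set. *)
pose S i w := if 0 < T i w then T i w else 1.
have mS i : measurable_fun setT (S i).
  by apply: measurable_fun_ifT => //; exact: measurable_fun_ltr.
have S0 i w : 0 < S i w by rewrite /S; case: ifP.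
have laplace_S (s : 'I_D -> R) : (forall i, 0 <= s i) ->
    \int[P2]_w expR (- \sum_i s i * S i w) = expR (- \sum_i s i `^ (alpha / 2)).
  move=> s0; rewrite expect_expR_indep// -sumrN expR_sum; apply: eq_bigr => i _.
  by rewrite /Rintegral laplace_T.
have prob := probability_sgr_neq mr mS S0 cos_r sin_r laplace_S u0 v0 u1 v1.
have mac (T' : 'I_D -> Omega2 -> R) : (forall i, measurable_fun setT (T' i)) ->
    measurable_fun setT (fun w => acos (cosine u v (T' ^~ w)) / pi).
  move=> mT'; apply: measurable_funM => //.
  by apply: measurableT_comp; [exact: measurable_acos|exact: measurable_cosine].
have bac := bmeas_acos_cosine mS S0 u0 v0 u1 v1.
have bacpi : bmeas (fun w => acos (cosine u v (S ^~ w)) / pi).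
  by apply: bmeasM => //; exact: bmeas_cst.
have TS : {ae P2, forall w, forall i, T i w = S i w}.
  by apply: filterS (ae_forall_ord T0) => w Tw i; rewrite /S Tw.
split.
  rewrite prob -EFin_Rintegral//; apply: ae_eq_integral => //.
  - by apply/measurable_EFinP; exact: mac.
  - by apply/measurable_EFinP; exact: mac.
  - apply: filterS TS => w Tw _; congr (EFin (acos _ / pi)).
    rewrite /cosine; congr (_ / Num.sqrt (_ * _)); by apply: eq_bigr => i _; rewrite Tw.
rewrite prob lee_fin.
have le_acos := expect_acos_cosine_le alpha0 mS S0 laplace_S u0 v0 u1 v1.
have -> : \int[P2]_w (acos (cosine u v (S ^~ w)) / pi) =
    pi^-1 * \int[P2]_w acos (cosine u v (S ^~ w)).
  by rewrite -expectZ//; under eq_Rintegral do rewrite mulrC.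
by rewrite mulrC ler_wpM2r// invr_ge0 pi_ge0.
Qed.
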